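(* With the kernels $K_{\rm tac}$ and $K_{\rm cr}$ defined in the context, the following hold as $u\to+\infty$. (i) For $r_1,r_2>0$ and $s_1,s_2\in\mathbb{R}$, $$K_{\rm tac}(u,u;r_1,r_2,s_1,s_2)=\frac{r_2\sqrt u}{\pi}-\frac{s_2}{\pi\sqrt u}-\frac1{4\pi u}\mathrm{Re}\,e^{2\psi_2(u)}+\mathcal{O}(u^{-3/2}),$$ where $\psi_2(\zeta)=\tfrac23r_2(-\zeta)^{3/2}+2s_2(-\zeta)^{1/2}$ and $\psi_2(u)$ is its boundary value on $(0,\infty)$ from the upper half-plane. (ii) For $s,t\in\mathbb{R}$, $$K_{\rm cr}(u,u;s,t)=\frac{\sqrt u}{\sqrt2\,\pi}+\frac t\pi+\frac{s}{\sqrt2\,\pi\sqrt u}+\mathcal{O}(u^{-3/2}).$$ Consequently these two expansions do not agree for any choice of the parameters, and hence the kernels are different.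
   Context: The RH problem for $M$. Fix angles $0<\varphi_1<\varphi_2<\pi/2$ and rays $\Gamma_0=\mathbb{R}^+$, $\Gamma_1=e^{i\varphi_1}\mathbb{R}^+$, $\Gamma_2=e^{i\varphi_2}\mathbb{R}^+$, $\Gamma_3=e^{i(\pi-\varphi_2)}\mathbb{R}^+$, $\Gamma_4=e^{i(\pi-\varphi_1)}\mathbb{R}^+$, $\Gamma_{5+k}=-\Gamma_k$ for $k=0,\dots,4$, all oriented from $0$ towards infinity; $\Sigma_M=\bigcup_k\Gamma_k$. The $+$ side (resp. $-$ side) of an oriented contour is on its left (resp. right). With $E_{ij}$ the $4\times4$ matrix units, put $J_0=E_{13}-E_{31}+E_{22}+E_{44}$, $J_1=I+E_{31}$, $J_2=I-E_{21}+E_{34}$, $J_3=I+E_{12}-E_{43}$, $J_4=I-E_{42}$, $J_5=E_{11}+E_{33}-E_{24}+E_{42}$, $J_6=I-E_{42}$, $J_7=I-E_{12}+E_{43}$, $J_8=I+E_{21}-E_{34}$, $J_9=I+E_{31}$. Given parameters $r_1,r_2,s_1,s_2,t$, $M$ is the $4\times4$ matrix function such that: (1) $M$ is analytic on $\mathbb{C}\setminus\Sigma_M$; (2) $M_+=M_-J_k$ on $\Gamma_k$; (3) as $\zeta\to\infty$, $$M(\zeta)=(I+\mathcal{O}(\zeta^{-1}))B(\zeta)A\,\mathrm{diag}\left(e^{-\psi_2(\zeta)+t\zeta},e^{-\psi_1(\zeta)-t\zeta},e^{\psi_2(\zeta)+t\zeta},e^{\psi_1(\zeta)-t\zeta}\right),$$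 with $\psi_1(\zeta)=\tfrac23r_1\zeta^{3/2}+2s_1\zeta^{1/2}$, $\psi_2(\zeta)=\tfrac23r_2(-\zeta)^{3/2}+2s_2(-\zeta)^{1/2}$, $$A=\frac1{\sqrt2}\begin{pmatrix}1&0&-i&0\\0&1&0&i\\-i&0&1&0\\0&i&0&1\end{pmatrix},\quad B(\zeta)=\mathrm{diag}\left((-\zeta)^{-1/4},\zeta^{-1/4},(-\zeta)^{1/4},\zeta^{1/4}\right);$$ (4) $M$ is bounded near $0$. Fractional powers of $\zeta$ are analytic in $\mathbb{C}\setminus(-\infty,0]$ and positive on $(0,\infty)$; those of $-\zeta$ are analytic in $\mathbb{C}\setminus[0,\infty)$ and positive on $(-\infty,0)$. The factor $I+\mathcal{O}(\zeta^{-1})$ in (3) has a full uniform asymptotic expansion in inverse powers of $\zeta$, which may be differentiated. The solution exists and is unique when $r_1,r_2>0$, $s_1,s_2\in\mathbb{R}$, $t=0$, and also when $r_1=r_2>0$, $s_1=s_2\in\mathbb{R}$, $t\in\mathbb{R}$. The kernel $K_{\rm tac}$: with $M$ the solution for parameters $r_1,r_2,s_1,s_2$ and $t=0$, for $u,v>0$, $$K_{\rm tac}(u,v;r_1,r_2,s_1,s_2)=\frac1{2\pi i(u-v)}\begin{pmatrix}-1&0&1&0\end{pmatrix}M_+^{-1}(v)M_+(u)\begin{pmatrix}1\\0\\1\\0\end{pmatrix}.$$ The kernel $K_{\rm cr}$: with $M$ the solution for $r_1=r_2=1$, $s_1=s_2=s$ and $t$, put $\widetilde M(\zeta)=M(i\zeta)^{-T}C_\pm$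 for $\pm\mathrm{Im}\,\zeta>0$ ($^{-T}$ is inverse transpose), with $$C_+=\begin{pmatrix}1&0&0&0\\0&-1&0&0\\0&0&0&-1\\0&0&-1&0\end{pmatrix},\qquad C_-=\begin{pmatrix}0&-1&0&0\\-1&0&0&0\\0&0&-1&0\\0&0&0&1\end{pmatrix},$$ let $\widetilde M_+(u)$ be the boundary value on $\mathbb{R}$ from the upper half-plane, and $$K_{\rm cr}(u,v;s,t)=\frac1{2\pi i(u-v)}\begin{pmatrix}-1&1&0&0\end{pmatrix}\widetilde M_+^{-1}(v)\widetilde M_+(u)\begin{pmatrix}1\\1\\0\\0\end{pmatrix}.$$ Diagonal values $K(u,u)$ are limits as $v\to u$. *)

(* Defs.v *)
From HB Require Import structures.
From mathcomp Require Import all_boot all_order all_algebra.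
From mathcomp Require Import all_classical all_reals all_analysis.
From mathcomp Require Import complex.
Set Implicit Arguments.
Unset Strict Implicit.
Unset Printing Implicit Defensive.
Import Order.TTheory GRing.Theory Num.Theory.
Import numFieldTopology.Exports numFieldNormedType.Exports.
Local Open Scope classical_set_scope.
Local Open Scope complex_scope.
Local Open Scope ring_scope.

Local Notation Re := complex.Re.
Local Notation Im := complex.Im.

(* R[i] inherits the topology and norm carried by every numFieldType. *)
Section ComplexTopology.
Variable R : realType.
Let K : numFieldType := R[i].
HB.instance Definition _ := NormedModule.copy R[i] K^o.
End ComplexTopology.

(* Makes +oo usable in the notations f u = g u +O_(u \near F) h u. *)
Definition pinfty_filter_on (K : numFieldType) : filter_on K :=
  FilterType (pinfty_nbhs K) (@filter_filter K _ proper_pinfty_nbhs).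

Section ComplexPowers.
Variable R : realType.
Local Notation C := R[i].

Definition cexp (z : C) : C :=
  (expR (Re z))%:C * (cos (Im z) +i* sin (Im z)).

Definition cmod (z : C) : R := Re `|z|.

(* Argument in ]-pi, pi]; continuous off ]-oo, 0]. *)
Definition carg (z : C) : R :=
  if 0 <= Im z then acos (Re z / cmod z) else - acos (Re z / cmod z).

Definition clog (z : C) : C := ln (cmod z) +i* carg z.

(* Principal power for z != 0: analytic off ]-oo, 0], positive on ]0, +oo[.
   Hence cpow (- z) a is analytic off [0, +oo[ and positive on ]-oo, 0[. *)
Definition cpow (z : C) (a : R) : C := cexp (a%:C * clog z).

Definition upper_side (z : C) : set_system C :=
  within [set w | 0 < Im w] (nbhs z).

Definition upper_lim (V : normedModType C) (f : C -> V) (u : R) : V :=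
  lim (f w @[w --> upper_side u%:C]).

Definition holomorphic_on (D : set C) (M : C -> 'M[C]_4) : Prop :=
  forall z, D z -> derivable M z 1.

(* N(z) ~ I + c_1 / z + c_2 / z^2 + ... as z tends to infinity, uniformly
   in D, the expansion being differentiable term by term any number of times.
   The case n = j = 0 says that N(z) = I + O(1/z). *)
Definition inverse_power_expansion (D : set C) (N : C -> 'M[C]_4) : Prop :=
  exists c : nat -> 'M[C]_4, c 0%N = 1%:M /\
    forall n j : nat, exists B r : R, forall z, D z -> r%:C < `|z| ->
      derivable (derive1n j N) z 1 /\
      `|derive1n j (fun w => N w - \sum_(k < n.+1) w ^- k *: c k) z|
        <= B%:C * `|z| ^- (n + j).+1.

End ComplexPowers.

Section RHProblem.
Variable R : realType.
Local Notation C := R[i].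

Definition mx4 (rows : seq (seq C)) : 'M[C]_4 :=
  \matrix_(i < 4, j < 4) (nth [::] rows i)`_j.

Definition diag4 (a b c d : C) : 'M[C]_4 :=
  diag_mx (\row_(j < 4) [:: a; b; c; d]`_j).

(* Matrix units, with indices running from 1 to 4. *)
Definition E (i j : nat) : 'M[C]_4 := delta_mx (inord i.-1) (inord j.-1).

Definition jumps : seq 'M[C]_4 :=
  [:: E 1 3 - E 3 1 + E 2 2 + E 4 4;
      1%:M + E 3 1;
      1%:M - E 2 1 + E 3 4;
      1%:M + E 1 2 - E 4 3;
      1%:M - E 4 2;
      E 1 1 + E 3 3 - E 2 4 + E 4 2;
      1%:M - E 4 2;
      1%:M - E 1 2 + E 4 3;
      1%:M + E 2 1 - E 3 4;
      1%:M + E 3 1].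

Definition jump (k : 'I_10) : 'M[C]_4 := nth 0 jumps k.

Section Contour.
Variables phi1 phi2 : R.

Definition ray_dir (k : 'I_10) : C :=
  let d := [seq cexp (0 +i* th)
           | th <- [:: 0; phi1; phi2; pi - phi2; pi - phi1]] in
  if (k < 5)%N then d`_k else - d`_(k - 5).

Definition Gamma (k : 'I_10) : set C :=
  [set x%:C * ray_dir k | x in [set x : R | 0 <= x]].

Definition Sigma_M : set C := \bigcup_(k in [set: 'I_10]) Gamma k.

End Contour.

(* The two sides, near z, of the line through 0 with direction d (|d| = 1),
   oriented by d; z / d rotates the line onto the real axis. *)
Definition left_side (d z : C) : set_system C :=
  within [set w | 0 < Im (w / d)] (nbhs z).
Definition right_side (d z : C) : set_system C :=
  within [set w | Im (w / d) < 0] (nbhs z).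

Definition psi1 (r1 s1 : R) (z : C) : C :=
  (2 / 3 * r1)%:C * cpow z (3 / 2) + (2 * s1)%:C * cpow z (1 / 2).

Definition psi2 (r2 s2 : R) (z : C) : C :=
  (2 / 3 * r2)%:C * cpow (- z) (3 / 2) + (2 * s2)%:C * cpow (- z) (1 / 2).

Definition Amx : 'M[C]_4 :=
  (Num.sqrt 2)^-1%:C *: mx4 [:: [::   1;   0; - 'i%C;  0];
                                [::   0;   1;    0; 'i%C];
                                [:: - 'i%C;  0;    1;  0];
                                [::   0;  'i%C;    0;  1]].

Definition Bmx (z : C) : 'M[C]_4 :=
  diag4 (cpow (- z) (- (1 / 4))) (cpow z (- (1 / 4)))
        (cpow (- z) (1 / 4)) (cpow z (1 / 4)).

Definition Dmx (r1 r2 s1 s2 t : R) (z : C) : 'M[C]_4 :=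
  diag4 (cexp (- psi2 r2 s2 z + t%:C * z)) (cexp (- psi1 r1 s1 z - t%:C * z))
        (cexp (psi2 r2 s2 z + t%:C * z)) (cexp (psi1 r1 s1 z - t%:C * z)).

(* M solves the Riemann-Hilbert problem; its values on Sigma_M are
   irrelevant. *)
Record RH_solution (phi1 phi2 r1 r2 s1 s2 t : R) (M : C -> 'M[C]_4) : Prop := {
  RH_analytic : holomorphic_on (~` Sigma_M phi1 phi2) M;
  RH_jump : forall (k : 'I_10) (x : R), 0 < x ->
    let d := ray_dir phi1 phi2 k in
    exists Mp Mm : 'M[C]_4,
      [/\ M w @[w --> left_side d (x%:C * d)] --> Mp,
          M w @[w --> right_side d (x%:C * d)] --> Mm &
          Mp = Mm *m jump k];
  RH_infinity : exists N : C -> 'M[C]_4,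
    inverse_power_expansion (~` Sigma_M phi1 phi2) N /\
    forall z, ~ Sigma_M phi1 phi2 z ->
      M z = N z *m Bmx z *m Amx *m Dmx r1 r2 s1 s2 t z;
  RH_origin : bounded_near M (within (~` Sigma_M phi1 phi2) (nbhs (0 : C)))
}.

(* (u, v) |-> l P(v)^-1 P(u) c / (2 pi i (u - v)), extended to the diagonal
   by its limit as v tends to u. *)
Definition kernel (l : 'rV[C]_4) (c : 'cV[C]_4) (P : R -> 'M[C]_4)
    (u v : R) : C :=
  let K v := (2 * pi%:C * 'i%C * (u - v)%:C)^-1
             * (l *m invmx (P v) *m P u *m c) 0 0 in
  if u == v then lim (K w @[w --> u^']) else K v.

(* For u > 0 the + side of R^+, oriented towards infinity, is the upper one. *)
Definition Ktac (M : C -> 'M[C]_4) : R -> R -> C :=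
  kernel (\row_(j < 4) [:: -1; 0; 1; 0]`_j) (\col_(i < 4) [:: 1; 0; 1; 0]`_i)
         (upper_lim M).

Definition Cplus : 'M[C]_4 :=
  mx4 [:: [:: 1;  0;  0;  0];
          [:: 0; -1;  0;  0];
          [:: 0;  0;  0; -1];
          [:: 0;  0; -1;  0]].

Definition Cminus : 'M[C]_4 :=
  mx4 [:: [::  0; -1;  0; 0];
          [:: -1;  0;  0; 0];
          [::  0;  0; -1; 0];
          [::  0;  0;  0; 1]].

Definition Mtilde (M : C -> 'M[C]_4) (z : C) : 'M[C]_4 :=
  (invmx (M ('i%C * z)))^T *m (if 0 < Im z then Cplus else Cminus).

Definition Kcr (M : C -> 'M[C]_4) : R -> R -> C :=
  kernel (\row_(j < 4) [:: -1; 1; 0; 0]`_j) (\col_(i < 4) [:: 1; 1; 0; 0]`_i)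
         (upper_lim (Mtilde M)).

Definition tac_expansion (r2 s2 : R) (u : R) : C :=
  (r2 * Num.sqrt u / pi - s2 / (pi * Num.sqrt u)
   - 1 / (4 * pi * u)
     * Re (cexp (2 * upper_lim (psi2 r2 s2 : C -> C) u)))%:C.

Definition cr_expansion (s t : R) (u : R) : C :=
  (Num.sqrt u / (Num.sqrt 2 * pi) + t / pi
   + s / (Num.sqrt 2 * pi * Num.sqrt u))%:C.

End RHProblem.

(* Main.v *)
(* With M_+ = N_+ P on the relevant half-line, where N = I + O(1/zeta) and
   P = B A D is explicit, and with l, c the row and column of the kernel (l c = 0),
     2 pi i K(u, u) = l M^-1 M' c = l P^-1 (N^-1 N') P c + l P^-1 P' c.
   In l P^-1 and P c the exponentials of D have reciprocal moduli and B, B^-1 grow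
   like u^(1/4), so N' = O(u^-2) makes the first term O(u^(1/4 - 2 + 1/4)); the
   second one is computed exactly.  On the positive axis, which lies on the contour,
   N_+ is differentiable because N and N' are Lipschitz in a convex sector above it.
   For the cross kernel, the imaginary axis avoids the contour and one argues with M
   there, K being the transpose of an expression of the same form.
   If the two expansions agreed, then for u = y^2 the cubic
   a y^3 + b y^2 + c y - cos(2 theta(y)) / (4 pi) would be O(1/y), forcing
   a = b = c = 0, while cos(2 theta) = 1 infinitely often. *)

Require Import Defs.
From mathcomp Require Import all_boot all_order all_algebra.
From mathcomp Require Import all_classical all_reals all_analysis.
From mathcomp Require Import complex.
From mathcomp Require Import ring lra.
Import Order.TTheory GRing.Theory Num.Theory.
Import numFieldTopology.Exports numFieldNormedType.Exports.
Local Open Scope classical_set_scope.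
Local Open Scope complex_scope.
Local Open Scope ring_scope.
Set Implicit Arguments.
Unset Strict Implicit.

(** * Complex numbers and limits of matrices *)

(** Since [N] enters only through its size, everything that survives in the two expansions comes
    from [P^-1 P' = D^-1 (A^-1 Q A / x) D + Delta], where [B' = B Q / x]. The matrix [A^-1 Q A]
    couples coordinate 1 with 3 and 2 with 4. The vectors of the tacnode kernel live on coordinates
    1 and 3, hence its oscillating term of order 1/u; those of the cross kernel, after
    multiplication by [Cplus], live on 1 and 2, hence no such term. A kernel on the diagonal is a
    limit along real v, so derivatives along a half-line are taken in a real variable, with values
    in complex matrices. The obstacle is the positive axis, where [N] is known only through its
    boundary values: a bound on [N''] gives a second-order Taylor estimate inside the sector, with a
    constant independent of the height above the axis, and this estimate passes to the boundary. *)

Lemma normCE (R : realType) (z : R[i]) : `|z| = (cmod z)%:C.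
Proof. by rewrite /cmod normc_def. Qed.

Lemma cmodE (R : realType) (z : R[i]) :
  cmod z = Num.sqrt (complex.Re z ^+ 2 + complex.Im z ^+ 2).
Proof. by rewrite /cmod normc_def. Qed.

Lemma cmod_ge0 (R : realType) (z : R[i]) : 0 <= cmod z.
Proof. by rewrite cmodE sqrtr_ge0. Qed.

Lemma cmod0 (R : realType) : cmod (0 : R[i]) = 0.
Proof. by rewrite cmodE /= expr0n /= addr0 sqrtr0. Qed.

Lemma cmodM (R : realType) (z w : R[i]) : cmod (z * w) = cmod z * cmod w.
Proof.
by apply: (@complexI R); rewrite rmorphM /= -!normCE normrM.
Qed.

Lemma cmodN (R : realType) (z : R[i]) : cmod (- z) = cmod z.
Proof. by rewrite /cmod normrN. Qed.

Lemma cmodB (R : realType) (z w : R[i]) : cmod (z - w) = cmod (w - z).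
Proof. by rewrite -cmodN opprB. Qed.

Lemma ler_cmodD (R : realType) (z w : R[i]) : cmod (z + w) <= cmod z + cmod w.
Proof. by rewrite -lecR rmorphD /= -!normCE ler_normD. Qed.

Lemma cmodR (R : realType) (x : R) : cmod x%:C = `|x|.
Proof. by rewrite cmodE /= expr0n /= addr0 sqrtr_sqr. Qed.

Lemma cmod_i (R : realType) : cmod ('i%C : R[i]) = 1.
Proof. by rewrite cmodE /= expr0n expr1n add0r sqrtr1. Qed.

Lemma Re_le_cmod (R : realType) (z : R[i]) : `|complex.Re z| <= cmod z.
Proof. by rewrite cmodE -sqrtr_sqr ler_wsqrtr // lerDl sqr_ge0. Qed.

Lemma Im_le_cmod (R : realType) (z : R[i]) : `|complex.Im z| <= cmod z.
Proof. by rewrite cmodE -sqrtr_sqr ler_wsqrtr // lerDr sqr_ge0. Qed.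

Lemma cmod_le_ReIm (R : realType) (z : R[i]) :
  cmod z <= `|complex.Re z| + `|complex.Im z|.
Proof.
have -> : z = (complex.Re z)%:C + 'i%C * (complex.Im z)%:C by exact: complexE.
apply: (le_trans (ler_cmodD _ _)).
by rewrite cmodM cmod_i !cmodR mul1r /= !(mul0r, mulr0, mul1r, mulr1, subr0, addr0, add0r).
Qed.

Lemma ReD (R : realType) (z w : R[i]) :
  complex.Re (z + w) = complex.Re z + complex.Re w.
Proof. by case: z w => ? ? [? ?]. Qed.

Lemma ImD (R : realType) (z w : R[i]) :
  complex.Im (z + w) = complex.Im z + complex.Im w.
Proof. by case: z w => ? ? [? ?]. Qed.

Lemma ReN (R : realType) (z : R[i]) : complex.Re (- z) = - complex.Re z.
Proof. by case: z. Qed.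

Lemma ImN (R : realType) (z : R[i]) : complex.Im (- z) = - complex.Im z.
Proof. by case: z. Qed.

Lemma ReM (R : realType) (z w : R[i]) : complex.Re (z * w)
  = complex.Re z * complex.Re w - complex.Im z * complex.Im w.
Proof. by case: z w => ? ? [? ?]. Qed.

Lemma ImM (R : realType) (z w : R[i]) : complex.Im (z * w)
  = complex.Re z * complex.Im w + complex.Im z * complex.Re w.
Proof. by case: z w => ? ? [? ?]. Qed.

Lemma complexP (R : realType) (z w : R[i]) :
  complex.Re z = complex.Re w -> complex.Im z = complex.Im w -> z = w.
Proof. by case: z w => ? ? [? ?] /= -> ->. Qed.

Lemma gt0_complexR (R : realType) (e : R[i]) :
  0 < e -> exists2 d : R, 0 < d & e = d%:C.
Proof. by case: e => a b; rewrite ltcE /= => /andP[/eqP -> a0]; exists a. Qed.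

Lemma cvgC_cmod (R : realType) (T : Type) (F : set_system T) {FF : Filter F}
    (f : T -> R[i]) (l : R[i]) :
  f x @[x --> F] --> l <->
  (forall e : R, 0 < e -> \forall x \near F, cmod (l - f x) < e).
Proof.
split=> [/cvgrPdist_lt h e e0|h].
  have /h : (0 : R[i]) < e%:C by rewrite ltcR.
  by apply: filterS => x; rewrite normCE ltcR.
apply/cvgrPdist_lt => _/gt0_complexR[e e0 ->].
by move: (h e e0); apply: filterS => x; rewrite normCE ltcR.
Qed.

Lemma cvgC_ReIm (R : realType) (T : Type) (F : set_system T) {FF : Filter F}
    (f : T -> R[i]) (l : R[i]) :
  f x @[x --> F] --> l <->
  (complex.Re (f x) @[x --> F] --> complex.Re l) /\
  (complex.Im (f x) @[x --> F] --> complex.Im l).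
Proof.
split=> [/cvgC_cmod h|[/cvgrPdist_lt h1 /cvgrPdist_lt h2]].
  split; apply/cvgrPdist_lt => e e0; move: (h e e0); apply: filterS => x.
    by apply: le_lt_trans; rewrite -ReN -ReD Re_le_cmod.
  by apply: le_lt_trans; rewrite -ImN -ImD Im_le_cmod.
apply/cvgC_cmod => e e0; have e2 : 0 < e / 2 by rewrite divr_gt0.
have := h2 _ e2; have := h1 _ e2; apply: filterS2 => x a b.
apply: (le_lt_trans (cmod_le_ReIm _)).
by rewrite ReD ReN ImD ImN [ltRHS]splitr ltrD.
Qed.

(** * The complex exponential *)

Lemma cexpD (R : realType) (z w : R[i]) : cexp (z + w) = cexp z * cexp w.
Proof.
rewrite /cexp ReD ImD expRD cosD sinD.
by apply: complexP; rewrite !(ReM, ImM) /=; ring.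
Qed.

Lemma cexp0 (R : realType) : cexp (0 : R[i]) = 1.
Proof. by rewrite /cexp /= expR0 cos0 sin0 mul1r. Qed.

Lemma cexpN (R : realType) (z : R[i]) : cexp (- z) * cexp z = 1.
Proof. by rewrite -cexpD addNr cexp0. Qed.

Lemma cmod_cexp (R : realType) (z : R[i]) : cmod (cexp z) = expR (complex.Re z).
Proof.
rewrite /cexp cmodM cmodR ger0_norm ?expR_ge0 // cmodE /= cos2Dsin2 sqrtr1.
by rewrite mulr1.
Qed.

Lemma Re_cexp (R : realType) (z : R[i]) :
  complex.Re (cexp z) = expR (complex.Re z) * cos (complex.Im z).
Proof. by rewrite /cexp ReM /= mul0r subr0. Qed.

Lemma Im_cexp (R : realType) (z : R[i]) :
  complex.Im (cexp z) = expR (complex.Re z) * sin (complex.Im z).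
Proof. by rewrite /cexp ImM /= mul0r addr0. Qed.

Lemma cvg_cexp (R : realType) (T : Type) (F : set_system T) {FF : Filter F}
    (f : T -> R[i]) (l : R[i]) :
  f x @[x --> F] --> l -> cexp (f x) @[x --> F] --> cexp l.
Proof.
move=> /cvgC_ReIm[h1 h2].
have e1 : expR (complex.Re (f x)) @[x --> F] --> expR (complex.Re l).
  by apply: continuous_cvg h1; exact: continuous_expR.
have e2 : cos (complex.Im (f x)) @[x --> F] --> cos (complex.Im l).
  by apply: continuous_cvg h2; exact: continuous_cos.
have e3 : sin (complex.Im (f x)) @[x --> F] --> sin (complex.Im l).
  by apply: continuous_cvg h2; exact: continuous_sin.
apply/cvgC_ReIm; split.
  by rewrite Re_cexp; under eq_cvg do rewrite Re_cexp; exact: cvgM.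
by rewrite Im_cexp; under eq_cvg do rewrite Im_cexp; exact: cvgM.
Qed.

(** * Norm, limits, determinant and inverse of matrices *)

Lemma normmx_entry (K : numFieldType) m n (A : 'M[K]_(m, n)) i j :
  `|A i j| <= `|A|.
Proof.
rewrite {2}/Num.norm /= mx_normE.
have -> : `|A i j| = (`|A (i, j).1 (i, j).2|%:nng)%:num by [].
by rewrite num_le; apply: (le_bigmax _ _ (i, j)).
Qed.

Lemma normmx_le (K : numFieldType) m n (A : 'M[K]_(m, n)) (e : K) :
  0 <= e -> (forall i j, `|A i j| <= e) -> `|A| <= e.
Proof.
move=> e0 h; rewrite /Num.norm /= mx_normE.
have -> : e = (NngNum e0)%:num by [].
by rewrite num_le; apply/bigmax_leP; split=> [|[i j] _]; rewrite -num_le /=.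
Qed.

(** The norm is the largest modulus of an entry, which is submultiplicative only up to the inner
    dimension. The powers of 4 in later estimates come from here. *)
Lemma normmxM (K : numFieldType) m n p (A : 'M[K]_(m, n)) (B : 'M[K]_(n, p)) :
  `|A *m B| <= n%:R * `|A| * `|B|.
Proof.
apply: normmx_le => [|i j]; first by rewrite !mulr_ge0.
rewrite mxE; apply: (le_trans (ler_norm_sum _ _ _)).
apply: (@le_trans _ _ (\sum_(k < n) (`|A| * `|B|))).
  by apply: ler_sum => k _; rewrite normrM ler_pM ?normmx_entry.
by rewrite sumr_const card_ord -mulrA mulr_natl.
Qed.

Lemma cvg_mxP (K : numFieldType) m n (T : Type) (F : set_system T)
    {FF : Filter F} (f : T -> 'M[K]_(m, n)) (l : 'M[K]_(m, n)) :
  f x @[x --> F] --> l <-> (forall i j, f x i j @[x --> F] --> l i j).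
Proof.
split=> [/cvgrPdist_lt h i j|h].
  apply/cvgrPdist_lt => e e0; move: (h e e0); apply: filterS => x.
  apply: le_lt_trans; apply: le_trans (normmx_entry (l - f x) i j).
  by rewrite !mxE.
apply/cvgrPdist_le => e e0.
have : \forall x \near F, forall ij : 'I_m * 'I_n, `|l ij.1 ij.2 - f x ij.1 ij.2| <= e.
  by apply: filter_forall => -[i j] /=; move/cvgrPdist_le: (h i j) => /(_ e e0).
apply: filterS => x hx; apply: normmx_le => [|i j]; first exact: ltW.
by move: (hx (i, j)); rewrite !mxE.
Qed.

Lemma cvg_sumr (K : numFieldType) (I : Type) (r : seq I) (P : pred I)
    (T : Type) (F : set_system T) {FF : Filter F} (f : I -> T -> K) (l : I -> K) :
  (forall i, f i x @[x --> F] --> l i) ->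
  \sum_(i <- r | P i) f i x @[x --> F] --> \sum_(i <- r | P i) l i.
Proof.
move=> h; elim: r => [|i r IH].
  by rewrite big_nil; under eq_cvg do rewrite big_nil; exact: cvg_cst.
rewrite big_cons; under eq_cvg do rewrite big_cons.
by case: (P i) => //; exact: cvgD.
Qed.

Lemma cvg_prodr (K : numFieldType) (I : Type) (r : seq I) (P : pred I)
    (T : Type) (F : set_system T) {FF : Filter F} (f : I -> T -> K) (l : I -> K) :
  (forall i, f i x @[x --> F] --> l i) ->
  \prod_(i <- r | P i) f i x @[x --> F] --> \prod_(i <- r | P i) l i.
Proof.
move=> h; elim: r => [|i r IH].
  by rewrite big_nil; under eq_cvg do rewrite big_nil; exact: cvg_cst.
rewrite big_cons; under eq_cvg do rewrite big_cons.
by case: (P i) => //; exact: cvgM.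
Qed.

Lemma cvg_mulmx (K : numFieldType) m n p (T : Type) (F : set_system T)
    {FF : Filter F} (f : T -> 'M[K]_(m, n)) (g : T -> 'M[K]_(n, p))
    (a : 'M[K]_(m, n)) (b : 'M[K]_(n, p)) :
  f x @[x --> F] --> a -> g x @[x --> F] --> b ->
  f x *m g x @[x --> F] --> a *m b.
Proof.
move=> /cvg_mxP hf /cvg_mxP hg; apply/cvg_mxP => i j; rewrite mxE.
under eq_cvg do rewrite mxE.
by apply: cvg_sumr => k; exact: cvgM.
Qed.

Lemma cvg_trmx (K : numFieldType) m n (T : Type) (F : set_system T)
    {FF : Filter F} (f : T -> 'M[K]_(m, n)) (a : 'M[K]_(m, n)) :
  f x @[x --> F] --> a -> (f x)^T @[x --> F] --> a^T.
Proof.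
move=> /cvg_mxP hf; apply/cvg_mxP => i j; rewrite mxE.
by under eq_cvg do rewrite mxE; exact: hf.
Qed.

Lemma cvg_det (K : numFieldType) n (T : Type) (F : set_system T)
    {FF : Filter F} (f : T -> 'M[K]_n) (a : 'M[K]_n) :
  f x @[x --> F] --> a -> \det (f x) @[x --> F] --> \det a.
Proof.
move=> /cvg_mxP hf; rewrite /determinant; apply: cvg_sumr => s.
by apply: cvgM; [exact: cvg_cst|exact: cvg_prodr].
Qed.

Lemma cvg_adj (K : numFieldType) n (T : Type) (F : set_system T)
    {FF : Filter F} (f : T -> 'M[K]_n) (a : 'M[K]_n) :
  f x @[x --> F] --> a -> \adj (f x) @[x --> F] --> \adj a.
Proof.
move=> /cvg_mxP hf; apply/cvg_mxP => i j; rewrite mxE.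
under eq_cvg do rewrite mxE.
apply: cvgM; first exact: cvg_cst.
apply: cvg_det; apply/cvg_mxP => k k'; rewrite !mxE.
by under eq_cvg do rewrite !mxE; exact: hf.
Qed.

Lemma near_unitmx (K : numFieldType) n (T : Type) (F : set_system T)
    {FF : Filter F} (f : T -> 'M[K]_n) (a : 'M[K]_n) :
  f x @[x --> F] --> a -> a \in unitmx ->
  \forall x \near F, f x \in unitmx.
Proof.
move=> /cvg_det /cvgrPdist_lt h; rewrite unitmxE unitfE => d0.
have /h : 0 < `|\det a| by rewrite normr_gt0.
apply: filterS => x; rewrite unitmxE unitfE; apply: contraTneq => ->.
by rewrite subr0 ltxx.
Qed.

Lemma cvg_invmx (K : numFieldType) n (T : Type) (F : set_system T)
    {FF : Filter F} (f : T -> 'M[K]_n) (a : 'M[K]_n) :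
  f x @[x --> F] --> a -> a \in unitmx ->
  invmx (f x) @[x --> F] --> invmx a.
Proof.
move=> hf ua; have near_u : \forall x \near F, f x \in unitmx by exact: near_unitmx hf ua.
(* [invmx] returns its argument on singular matrices, so the adjugate formula holds only where [f x]
   is invertible. *)
have E : {near F, (fun x => (\det (f x))^-1 *: \adj (f x)) =1 (fun x => invmx (f x))}.
  by move: near_u; apply: filterS => x ux; rewrite /invmx ux.
apply: cvg_trans (near_eq_cvg E) _.
rewrite /invmx ua; apply: cvgZ; last exact: cvg_adj.
by apply: cvgV; [rewrite -unitfE -unitmxE|exact: cvg_det].
Qed.

(** * Difference quotients and the mean value inequality *)

Lemma cvg_near_eq (T : Type) (U : topologicalType) (F : set_system T)
    {FF : Filter F} (f g : T -> U) (l : set_system U) :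
  (\forall x \near F, f x = g x) -> f x @[x --> F] `=>` l ->
  g x @[x --> F] `=>` l.
Proof. by move=> E; apply: cvg_trans; exact: near_eq_cvg. Qed.

(** A derivative in a real variable of a function with values over the complex numbers, written as
    the punctured limit that also defines the diagonal of a kernel. *)
Definition has_diffquo (R : realType) (V : normedModType R[i]) (f : R -> V)
    (u : R) (l : V) : Prop :=
  ((v - u)^-1)%:C *: (f v - f u) @[v --> u^'] --> l.

Definition has_cderiv (R : realType) (F : R[i] -> R[i]) (z l : R[i]) : Prop :=
  h^-1 * (F (h + z) - F z) @[h --> 0^'] --> l.

Lemma cvg_dnbhs_sub (R : realType) (u : R) : (v - u) @[v --> u^'] --> (0 : R)^'.
Proof.
have h : (v - u) @[v --> u] --> (0 : R).
  by rewrite -(subrr u); apply: (@cvgB _ _ _ (nbhs u)); [exact: cvg_id|exact: cvg_cst].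
move=> A /h hA; have {}hA : \forall v \near u, v - u != 0 -> A (v - u) := hA.
change (\forall v \near u, v != u -> A (v - u)).
by move: hA; apply: filterS => v Av vu; apply: Av; rewrite subr_eq0.
Qed.

Lemma cvg_dnbhs_dir (R : realType) (d : R[i]) : d != 0 ->
  (h%:C * d) @[h --> (0 : R)^'] --> (0 : R[i])^'.
Proof.
move=> d0.
have h : (h%:C * d) @[h --> (0 : R)] --> (0 : R[i]).
  rewrite -[X in _ --> X](mul0r d); apply: (@cvgM _ _ (nbhs (0 : R))); last exact: cvg_cst.
  by apply/cvgC_ReIm; split=> /=; [exact: cvg_id|exact: cvg_cst].
move=> A /h hA; have {}hA : \forall v \near (0 : R), v%:C * d != 0 -> A (v%:C * d) := hA.
change (\forall v \near (0 : R), v != 0 -> A (v%:C * d)).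
move: hA; apply: filterS => v Av v0; apply: Av; rewrite mulf_neq0 //.
by apply: contra v0 => /eqP/complexI ->.
Qed.

Lemma diffquo_is_derive (R : realType) (f : R -> R) (u l : R) :
  is_derive u 1 f l -> (v - u)^-1 * (f v - f u) @[v --> u^'] --> l.
Proof.
case=> /cvg_ex[/= l' hl'] <-.
have -> : 'D_1 f u = l' by exact: cvg_lim.
have H := cvg_comp _ _ (@cvg_dnbhs_sub R u) hl'; apply: (cvg_near_eq _ H); near=> v.
by rewrite /= /GRing.scale /= mulr1 subrK.
Unshelve. all: by end_near. Qed.

Lemma has_diffquo_ReIm (R : realType) (f : R -> R[i]) (u : R) (l : R[i]) :
  is_derive u 1 (fun v => complex.Re (f v)) (complex.Re l) ->
  is_derive u 1 (fun v => complex.Im (f v)) (complex.Im l) ->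
  has_diffquo f u l.
Proof.
move=> /diffquo_is_derive h1 /diffquo_is_derive h2.
apply/cvgC_ReIm; split.
  apply: cvg_near_eq h1; near=> v.
  by rewrite /= /GRing.scale /= ReM /= mul0r subr0 ReD ReN.
apply: cvg_near_eq h2; near=> v.
by rewrite /= /GRing.scale /= ImM /= mul0r addr0 ImD ImN.
Unshelve. all: by end_near. Qed.

Lemma cvg_subC0 (R : realType) (u : R) : (v - u)%:C @[v --> u^'] --> (0 : R[i]).
Proof.
apply/cvgC_ReIm; split=> /=; last exact: cvg_cst.
exact: cvg_trans (@cvg_dnbhs_sub R u) (@cvg_within _ _ _ _).
Qed.

Lemma has_diffquo_cvg (R : realType) (V : normedModType R[i]) (f : R -> V)
    (u : R) (l : V) : has_diffquo f u l -> f v @[v --> u^'] --> f u.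
Proof.
move=> h.
have := cvgD (cvg_cst (f u)) (cvgZ (@cvg_subC0 R u) h).
rewrite scale0r addr0 => /(_ _ _ _) H; apply: (cvg_near_eq _ H); near=> v.
rewrite /= /cst /= scalerA -rmorphM /= divff ?scale1r ?subrKC //.
rewrite subr_eq0; near: v; exact: nbhs_dnbhs_neq.
Unshelve. all: by end_near. Qed.

Lemma has_diffquo_mxP (R : realType) m n (f : R -> 'M[R[i]]_(m, n)) (u : R)
    (l : 'M[R[i]]_(m, n)) :
  has_diffquo f u l <-> (forall i j, has_diffquo (fun v => f v i j) u (l i j)).
Proof.
rewrite /has_diffquo; split=> [/cvg_mxP h i j|h].
  by have := h i j; under eq_cvg do rewrite !mxE.
by apply/cvg_mxP => i j; under eq_cvg do rewrite !mxE; exact: h.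
Qed.

Lemma has_diffquo_mulmx (R : realType) m n p (f : R -> 'M[R[i]]_(m, n))
    (g : R -> 'M[R[i]]_(n, p)) (u : R) df dg :
  has_diffquo f u df -> has_diffquo g u dg ->
  has_diffquo (fun v => f v *m g v) u (df *m g u + f u *m dg).
Proof.
move=> hf hg.
have H1 : (((v - u)^-1)%:C *: (f v - f u)) *m g u @[v --> u^'] --> df *m g u.
  by apply: cvg_mulmx hf _; exact: cvg_cst.
have H2 : f v *m (((v - u)^-1)%:C *: (g v - g u)) @[v --> u^'] --> f u *m dg.
  by apply: cvg_mulmx hg; exact: has_diffquo_cvg hf.
apply: (cvg_near_eq _ (cvgD H1 H2)); near=> v.
rewrite /= -scalemxAl -scalemxAr -scalerDr; congr (_ *: _).
by rewrite mulmxBl mulmxBr addrC addrA subrK.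
Unshelve. all: by end_near. Qed.

Lemma has_diffquo_cst (R : realType) (V : normedModType R[i]) (u : R) (a : V) :
  has_diffquo (fun=> a) u 0.
Proof.
by rewrite /has_diffquo; under eq_cvg do rewrite subrr scaler0; exact: cvg_cst.
Qed.

Lemma has_cderiv_entry (R : realType) n (N : R[i] -> 'M[R[i]]_n) (z : R[i]) i j :
  derivable N z 1 -> has_cderiv (fun w => N w i j) z (derive1 N z i j).
Proof.
case/cvg_ex => /= l hl.
have {}hl : h^-1 *: (N (h + z) - N z) @[h --> 0^'] --> l.
  apply: (cvg_near_eq _ hl); near=> h.
  by rewrite /GRing.scale /= mulr1.
have -> : derive1 N z = l by apply: cvg_lim hl; exact: norm_hausdorff.
move: hl => /cvg_mxP /(_ i j) hl; apply: (cvg_near_eq _ hl); near=> h.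
by rewrite !mxE.
Unshelve. all: by end_near. Qed.

Lemma has_cderivB_linear (R : realType) (F : R[i] -> R[i]) (z l a : R[i]) :
  has_cderiv F z l -> has_cderiv (fun w => F w - a * w) z (l - a).
Proof.
rewrite /has_cderiv => h.
have ca : (fun=> a) x @[x --> (0 : R[i])^'] --> a by exact: cvg_cst.
apply: (cvg_near_eq _ (cvgB h ca)); near=> w.
have w0 : w != 0 by near: w; exact: nbhs_dnbhs_neq.
by rewrite !fctE; field.
Unshelve. all: by end_near. Qed.

Lemma has_cderivZ (R : realType) (F : R[i] -> R[i]) (z l a : R[i]) :
  has_cderiv F z l -> has_cderiv (fun w => a * F w) z (a * l).
Proof.
rewrite /has_cderiv => h.
have ca : (fun=> a) x @[x --> (0 : R[i])^'] --> a by exact: cvg_cst.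
apply: (cvg_near_eq _ (cvgM ca h)); near=> w.
by rewrite /= /cst; ring.
Unshelve. all: by end_near. Qed.

Lemma has_cderiv_segment (R : realType) (F : R[i] -> R[i]) (w d l : R[i]) (s : R) :
  has_cderiv F (w + s%:C * d) l ->
  is_derive s 1 (fun t : R => complex.Re (F (w + t%:C * d))) (complex.Re (l * d)).
Proof.
move=> hF; suff H : h^-1 *: (complex.Re (F (w + (h *: 1 + s)%:C * d))
    - complex.Re (F (w + s%:C * d))) @[h --> 0^'] --> complex.Re (l * d).
  by apply: DeriveDef; [apply/cvg_ex; exists (complex.Re (l * d))|exact: cvg_lim H].
(* A degenerate segment gives a constant function. Otherwise [h%:C * d] runs through punctured
   neighbourhoods of 0, and the complex difference quotient restricts to the line. *)
have [->|d0] := eqVneq d 0.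
  by rewrite !mulr0; under eq_cvg do rewrite !mulr0 subrr scaler0; exact: cvg_cst.
have H1 := cvg_comp _ _ (cvg_dnbhs_dir d0) hF.
have cd : (fun=> d) x @[x --> (0 : R)^'] --> d by exact: cvg_cst.
have /(_ _)/cvgC_ReIm[H _] := cvgM H1 cd.
apply: (cvg_near_eq _ H); near=> h.
have h0 : h != 0 by near: h; exact: nbhs_dnbhs_neq.
have hC0 : h%:C != 0 by apply: contra h0 => /eqP/complexI ->.
rewrite /= /cst /=.
have -> : h%:C * d + (w + s%:C * d) = w + (h *: 1 + s)%:C * d.
  by rewrite /GRing.scale /= mulr1 rmorphD /=; ring.
set X := F (w + _); set Y := F (w + _).
have -> : (h%:C * d)^-1 * (X - Y) * d = (h^-1)%:C * (X - Y).
  by rewrite fmorphV /=; field; rewrite d0 hC0.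
by rewrite ReM /= mul0r subr0 ReD ReN.
Unshelve. all: by end_near. Qed.

Lemma mean_value_Re (R : realType) (F F' : R[i] -> R[i]) (w d : R[i]) (K : R) :
  (forall s : R, 0 <= s <= 1 -> has_cderiv F (w + s%:C * d) (F' (w + s%:C * d))) ->
  (forall s : R, 0 <= s <= 1 -> cmod (F' (w + s%:C * d)) <= K) ->
  `|complex.Re (F (w + d) - F w)| <= K * cmod d.
Proof.
move=> dF bF.
have dRe (s : R) : 0 <= s <= 1 -> is_derive s 1
    (fun t : R => complex.Re (F (w + t%:C * d))) (complex.Re (F' (w + s%:C * d) * d)).
  by move=> /dF; exact: has_cderiv_segment.
have [s||c] := @MVT_segment R (fun t : R => complex.Re (F (w + t%:C * d)))
  (fun s => complex.Re (F' (w + s%:C * d) * d)) 0 1 ler01.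
- by rewrite in_itv /= => /andP[s0 s1]; apply: dRe; rewrite !ltW.
- apply: derivable_within_continuous => x; rewrite in_itv /= => /dRe dx.
  exact: ex_derive.
rewrite in_itv /= => c01; rewrite mul1r mul0r addr0 subr0 mulr1 ReD ReN => ->.
apply: (le_trans (Re_le_cmod _)); rewrite cmodM.
by apply: ler_wpM2r; [exact: cmod_ge0|exact: bF].
Qed.

(** A complex function need not have a mean value point, so the real theorem is applied separately
    to the real parts of [F] and of [-i F], the latter being the imaginary part of [F]. This costs
    the factor 2. *)
Lemma mean_value_cmod (R : realType) (F F' : R[i] -> R[i]) (w d : R[i]) (K : R) :
  (forall s : R, 0 <= s <= 1 -> has_cderiv F (w + s%:C * d) (F' (w + s%:C * d))) ->
  (forall s : R, 0 <= s <= 1 -> cmod (F' (w + s%:C * d)) <= K) ->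
  cmod (F (w + d) - F w) <= 2 * K * cmod d.
Proof.
move=> dF bF; apply: (le_trans (cmod_le_ReIm _)).
rewrite -mulrA mulr_natl mulr2n; apply: lerD; first exact: mean_value_Re dF bF.
have := @mean_value_Re R (fun z => - 'i%C * F z) (fun z => - 'i%C * F' z) w d K.
rewrite -mulrBr ReM /= oppr0 mul0r sub0r mulN1r opprK; apply.
  by move=> s /dF; exact: has_cderivZ.
by move=> s s01; rewrite cmodM cmodN cmod_i mul1r; exact: bF.
Qed.

(** * Boundary values on the real axis *)

Lemma cvgC_cauchy (R : realType) (T : Type) (F : set_system T)
    {FF : ProperFilter F} (f : T -> R[i]) :
  (forall e : R, 0 < e -> exists2 A, F A &
    forall x y, A x -> A y -> cmod (f x - f y) < e) ->
  exists l : R[i], f x @[x --> F] --> l.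
Proof.
move=> h.
have H (g : R[i] -> R) : (forall z w, `|g z - g w| <= cmod (z - w)) ->
    cvg (g (f x) @[x --> F]).
  move=> gle; apply/cauchy_cvgP/cauchy_exP => _/posnumP[e].
  have [A FA Ae] := h e%:num (gt0 e).
  have [x Ax] := filter_ex FA; exists (g (f x)).
  apply: (@filterS _ F _ A) => // y Ay.
  by apply: (le_lt_trans (gle _ _)); exact: Ae.
have /cvg_ex[/= a ha] : cvg (complex.Re (f x) @[x --> F]).
  by apply: H => z w; rewrite -ReN -ReD Re_le_cmod.
have /cvg_ex[/= b hb] : cvg (complex.Im (f x) @[x --> F]).
  by apply: H => z w; rewrite -ImN -ImD Im_le_cmod.
by exists (a +i* b); apply/cvgC_ReIm.
Qed.

Lemma cvgC_cmod_le (R : realType) (T : Type) (F : set_system T)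
    {FF : ProperFilter F} (f : T -> R[i]) (l : R[i]) (c : R) :
  f x @[x --> F] --> l -> (\forall x \near F, cmod (f x) <= c) -> cmod l <= c.
Proof.
move=> /cvgC_cmod h hc; rewrite leNgt; apply/negP => cl.
have /h h1 : 0 < cmod l - c by rewrite subr_gt0.
have [x [/= a b]] := filter_ex (filterI h1 hc).
have := ler_cmodD (l - f x) (f x); rewrite subrK; lra.
Qed.

(** Vertical approach makes the one-sided filter proper. It also lets u and v be approached at the
    same height, so that the difference of the two points stays real and constant. *)
Lemma cvg_upper_vertical (R : realType) (x : R) :
  (x +i* y) @[y --> (0 : R)^'+] --> upper_side x%:C.
Proof.
have h : (x +i* y) @[y --> (0 : R)^'+] --> x%:C.
  apply/cvgC_ReIm; split=> /=; first exact: cvg_cst.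
  exact: cvg_within.
move=> A; rewrite /upper_side => hA.
have hA' : \forall w \near x%:C, 0 < complex.Im w -> A w := hA.
have := h _ hA'; have := nbhs_right_gt (0 : R).
by apply: filterS2 => y y0; exact.
Qed.

Global Instance upper_side_filter (R : realType) (x : R) :
  ProperFilter (upper_side x%:C).
Proof.
apply: Build_ProperFilter_ex => A hA.
have [y Ay] := filter_ex (cvg_upper_vertical hA).
by exists y.
Qed.

Lemma upper_limP (R : realType) (V : normedModType R[i]) (f : R[i] -> V) (x : R)
    (l : V) : f w @[w --> upper_side x%:C] --> l -> upper_lim f x = l.
Proof. by move=> h; apply: cvg_lim h; exact: norm_hausdorff. Qed.

Definition cvxset (R : realType) (S : set R[i]) : Prop :=
  forall w z (s : R), S w -> S z -> 0 <= s <= 1 -> S (w + s%:C * (z - w)).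

Lemma lipschitz_cderiv (R : realType) (S : set R[i]) (F F1 : R[i] -> R[i])
    (K : R) : cvxset S ->
  (forall w, S w -> has_cderiv F w (F1 w)) ->
  (forall w, S w -> cmod (F1 w) <= K) ->
  forall w z, S w -> S z -> cmod (F z - F w) <= 2 * K * cmod (z - w).
Proof.
move=> cS dF bF w z Sw Sz; rewrite -{1}(subrKC w z).
by apply: (@mean_value_cmod _ _ F1) => s s01; [apply: dF|apply: bF]; exact: cS.
Qed.

(** The mean value inequality is used twice: for [F z - F1 w * z], whose derivative is
    [F1 z - F1 w], and for [F1] itself, to bound that derivative. *)
Lemma taylor2_cderiv (R : realType) (S : set R[i]) (F F1 F2 : R[i] -> R[i])
    (K : R) : cvxset S ->
  (forall w, S w -> has_cderiv F w (F1 w)) ->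
  (forall w, S w -> has_cderiv F1 w (F2 w)) ->
  (forall w, S w -> cmod (F2 w) <= K) ->
  forall w z, S w -> S z ->
    cmod (F z - F w - F1 w * (z - w)) <= 4 * K * cmod (z - w) ^+ 2.
Proof.
move=> cS dF dF1 bF w z Sw Sz.
have K0 : 0 <= K by apply: le_trans (bF _ Sw); exact: cmod_ge0.
have -> : F z - F w - F1 w * (z - w)
   = (F (w + (z - w)) - F1 w * (w + (z - w))) - (F w - F1 w * w).
  by rewrite subrKC; ring.
have -> : 4 * K * cmod (z - w) ^+ 2 = 2 * (2 * K * cmod (z - w)) * cmod (z - w).
  by ring.
apply: (@mean_value_cmod _ (fun z => F z - F1 w * z) (fun z => F1 z - F1 w)).
  by move=> s s01; apply: has_cderivB_linear; apply: dF; exact: cS.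
move=> s /andP[s0 s1].
have Ss : S (w + s%:C * (z - w)) by apply: cS => //; rewrite s0.
apply: (le_trans (lipschitz_cderiv cS dF1 bF Sw Ss)).
rewrite addrC addKr cmodM cmodR ger0_norm // ler_wpM2l ?mulr_ge0 //.
by rewrite ler_piMl // cmod_ge0.
Qed.

(** A Lipschitz function on a convex set is Cauchy along any filter that contains the set and
    converges to x. *)
Lemma cvg_upper_lim (R : realType) (S : set R[i]) (F F1 : R[i] -> R[i])
    (K x : R) : cvxset S ->
  (forall w, S w -> has_cderiv F w (F1 w)) ->
  (forall w, S w -> cmod (F1 w) <= K) ->
  upper_side x%:C S ->
  F w @[w --> upper_side x%:C] --> upper_lim (F : R[i] -> R[i]) x.
Proof.
move=> cS dF bF xS.
suff [l hl] : exists l : R[i], F w @[w --> upper_side x%:C] --> l.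
  by rewrite (upper_limP hl).
apply: cvgC_cauchy => e e0.
have [w0 Sw0] := filter_ex xS.
have K0 : 0 <= K by apply: le_trans (bF _ Sw0); exact: cmod_ge0.
(* Two points within [d] of x are at most [2 d] apart, so the values differ by at most [4 K d],
   which is below [e]. Using [K + 1] avoids dividing by zero. *)
pose d := e / (8 * (K + 1)).
have d0 : 0 < d by rewrite divr_gt0 // mulr_gt0 // ltr_wpDl.
have hid : w @[w --> upper_side x%:C] --> x%:C by exact: cvg_within.
have hd : \forall w \near upper_side x%:C, cmod (x%:C - w) < d.
  by move/cvgC_cmod: hid => /(_ d d0).
exists (S `&` [set w | cmod (x%:C - w) < d]); first exact: filterI.
move=> w z [Sw /= wd] [Sz /= zd].
apply: (le_lt_trans (lipschitz_cderiv cS dF bF Sz Sw)).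
have wz : cmod (w - z) <= d + d.
  have -> : w - z = (w - x%:C) + (x%:C - z) by ring.
  by apply: (le_trans (ler_cmodD _ _)); rewrite cmodB; lra.
apply: (@le_lt_trans _ _ (2 * K * (d + d))); first by rewrite ler_wpM2l ?mulr_ge0.
have -> : 2 * K * (d + d) = e * (K / (2 * (K + 1))) by rewrite /d; field; lra.
rewrite gtr_pMr // ltr_pdivrMr ?mulr_gt0 //; lra.
Qed.

Lemma near_upper_vertical (R : realType) (S : set R[i]) (x : R) :
  upper_side x%:C S -> \forall y \near (0 : R)^'+, S (x +i* y).
Proof. by move=> xS; exact: (cvg_upper_vertical xS). Qed.

Lemma diffquo_sub_mul (R : realType) (x : R) (a b : R[i]) : x != 0 ->
  ((x^-1)%:C *: a - b) * x%:C = a - b * x%:C.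
Proof.
move=> x0; have xC : x%:C != 0 :> R[i] by apply: contra x0 => /eqP/complexI ->.
by rewrite mulrBl /GRing.scale /= mulrAC -rmorphM mulVf // mul1r.
Qed.

Lemma has_diffquo_upper_lim (R : realType) (S : set R[i])
    (F F1 F2 : R[i] -> R[i]) (K u : R) : cvxset S ->
  (forall w, S w -> has_cderiv F w (F1 w)) ->
  (forall w, S w -> has_cderiv F1 w (F2 w)) ->
  (forall w, S w -> cmod (F1 w) <= K) ->
  (forall w, S w -> cmod (F2 w) <= K) ->
  (\forall x \near u, upper_side x%:C S) ->
  has_diffquo (upper_lim (F : R[i] -> R[i])) u (upper_lim (F1 : R[i] -> R[i]) u).
Proof.
move=> cS dF dF1 bF bF1 uS.
have xS := nbhs_singleton uS.
have uS' : \forall x \near u^', upper_side x%:C S.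
  change (\forall x \near u, x != u -> upper_side x%:C S).
  by apply: filterS uS => x ? _.
(* Taylor's inequality between [u +i* y] and [v +i* y]: its right-hand side does not depend on y, so
   it survives the limit as y tends to 0 from above. *)
have est (v : R) : upper_side v%:C S ->
    cmod (upper_lim (F : R[i] -> R[i]) v - upper_lim (F : R[i] -> R[i]) u
      - upper_lim (F1 : R[i] -> R[i]) u * (v - u)%:C) <= 4 * K * `|v - u| ^+ 2.
  move=> vS.
  have hv := cvg_comp _ _ (@cvg_upper_vertical R v) (cvg_upper_lim cS dF bF vS).
  have hu := cvg_comp _ _ (@cvg_upper_vertical R u) (cvg_upper_lim cS dF bF xS).
  have h1 := cvg_comp _ _ (@cvg_upper_vertical R u) (cvg_upper_lim cS dF1 bF1 xS).
  have cc : (fun=> (v - u)%:C) x @[x --> (0 : R)^'+] --> (v - u)%:C by exact: cvg_cst.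
  apply: (cvgC_cmod_le (cvgB (cvgB hv hu) (cvgM h1 cc))).
  have := near_upper_vertical vS; have := near_upper_vertical xS.
  apply: filterS2 => y Su Sv.
  have := taylor2_cderiv cS dF dF1 bF1 Su Sv.
  have -> : v +i* y - u +i* y = (v - u)%:C by apply: complexP; rewrite /= ?subrr.
  by rewrite cmodR.
have [w0 Sw0] := filter_ex xS.
have K0 : 0 <= K by apply: le_trans (bF _ Sw0); exact: cmod_ge0.
apply/cvgC_cmod => e e0; near=> v.
have vu : v - u != 0 by rewrite subr_eq0; near: v; exact: nbhs_dnbhs_neq.
have vuC : (v - u)%:C != 0 by apply: contra vu => /eqP/complexI ->.
have vS : upper_side v%:C S by near: v; exact: uS'.
rewrite cmodB -(ltr_pM2r (x := `|v - u|)) ?normr_gt0 // -{1}(cmodR (v - u)) -cmodM.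
have -> : (((v - u)^-1)%:C *: (upper_lim (F : R[i] -> R[i]) v
   - upper_lim (F : R[i] -> R[i]) u) - upper_lim (F1 : R[i] -> R[i]) u) * (v - u)%:C
   = upper_lim (F : R[i] -> R[i]) v - upper_lim (F : R[i] -> R[i]) u
      - upper_lim (F1 : R[i] -> R[i]) u * (v - u)%:C.
  by rewrite diffquo_sub_mul.
apply: (le_lt_trans (est v vS)).
rewrite expr2 mulrA ltr_pM2r ?normr_gt0 //.
have h : `|v - u| < e / (4 * (K + 1)).
  near: v; apply: (@cvgr_distC_lt _ _ _ _ _ (fun v : R => v) u).
    exact: cvg_within.
  by rewrite divr_gt0 // mulr_gt0 //; lra.
rewrite (@le_lt_trans _ _ (4 * K * (e / (4 * (K + 1))))) //.
  by rewrite ler_wpM2l ?mulr_ge0 // ltW.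
have -> : 4 * K * (e / (4 * (K + 1))) = e * (K / (K + 1)) by field; lra.
rewrite gtr_pMr // ltr_pdivrMr; lra.
Unshelve. all: by end_near. Qed.

(** * The factor N on the two half-lines *)

Lemma derive1_subr_cst (K : numFieldType) (V : normedModType K) (f : K -> V) (a : V) :
  derive1 (fun w => f w - a) = derive1 f.
Proof.
apply/funext => z; rewrite /derive1; under eq_fun do rewrite opprB addrA addrNK; done.

Qed.

Lemma normmx_entry_cmod (R : realType) n (A : 'M[R[i]]_n) (e : R) i j :
  `|A| <= e%:C -> cmod (A i j) <= e.
Proof.
by move=> h; rewrite -lecR -normCE; apply: le_trans h; exact: normmx_entry.
Qed.

(** The expansion with n = 0 and j = 0, 1, 2. The subtracted term is the constant I and disappears
    on differentiation, so the last two cases bound [N'] and [N''] themselves. *)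
Lemma inverse_power_expansion_bounds (R : realType) (D : set R[i])
    (N : R[i] -> 'M[R[i]]_4) : inverse_power_expansion D N ->
  exists B r : R, [/\ 0 <= B, 1 <= r & forall z, D z -> r < cmod z ->
    [/\ derivable N z 1, derivable (derive1 N) z 1,
        forall i j, cmod (N z i j - (i == j)%:R) <= B / cmod z,
        forall i j, cmod (derive1 N z i j) <= B / cmod z ^+ 2 &
        forall i j, cmod (derive1 (derive1 N) z i j) <= B / cmod z ^+ 3]].
Proof.
case=> c [c0 h].
have [B0 [r0 h0]] := h 0%N 0%N.
have [B1 [r1 h1]] := h 0%N 1%N.
have [B2 [r2 h2]] := h 0%N 2%N.
have E : (fun w => N w - \sum_(k < 1) w ^- k *: c k) = (fun w => N w - 1%:M).
  by apply/funext => w; rewrite big_ord1 expr0 invr1 scale1r c0.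
rewrite E in h0 h1 h2.
rewrite !derive1n1 derive1_subr_cst in h1.
rewrite !derive1nS !derive1n0 derive1_subr_cst in h2.
(* The given constants may have any sign; absolute values yield one nonnegative [B] and one radius
   at least 1 that serve all three bounds. *)
pose B := `|B0| + `|B1| + `|B2|; pose r := 1 + `|r0| + `|r1| + `|r2|.
have := (normr_ge0 r0, normr_ge0 r1, normr_ge0 r2, normr_ge0 B0, normr_ge0 B1, normr_ge0 B2).
move=> [[[[[n0 n1] n2] m0] m1] m2].
have B_ge0 : 0 <= B by rewrite /B; lra.
exists B, r; split=> // [|z Dz rz]; first by rewrite /r; lra.
have z0 : 0 < cmod z by apply: lt_trans rz; rewrite /r; lra.
have rr (s : R) : `|s| <= r -> s%:C < `|z|.
  by move=> sr; rewrite normCE ltcR (le_lt_trans (ler_norm s)) // (le_lt_trans sr).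
have BB (b : R) k (A : 'M[R[i]]_4) i j : `|b| <= B -> `|A| <= b%:C * `|z| ^- k ->
    cmod (A i j) <= B / cmod z ^+ k.
  move=> bB hA; apply: (@normmx_entry_cmod _ _ A); apply: (le_trans hA).
  rewrite normCE -rmorphXn -fmorphV -rmorphM lecR ler_wpM2r //.
    by rewrite invr_ge0 exprn_ge0 // ltW.
  exact: le_trans (ler_norm b) bB.
have [d0 b0] : derivable N z 1 /\ _ := h0 z Dz (rr r0 ltac:(rewrite /r; lra)).
have [d1 b1] : derivable (derive1 N) z 1 /\ _ := h1 z Dz (rr r1 ltac:(rewrite /r; lra)).
have [_ b2] := h2 z Dz (rr r2 ltac:(rewrite /r; lra)).
have lB : [/\ `|B0| <= B, `|B1| <= B & `|B2| <= B].
  by split; rewrite /B; lra.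
case: lB => lB0 lB1 lB2.
split=> // i j.
- have := BB _ 1%N (N z - 1%:M) i j lB0 b0.
  by rewrite expr1 !mxE.
- exact: BB lB1 b1.
- exact: BB lB2 b2.
Qed.

(* A convex neighbourhood at infinity of the positive axis inside the component
   0 < arg w < phi of the complement of the contour. *)
Definition sector (R : realType) (phi r : R) : set R[i] :=
  [set w | [/\ 0 < complex.Im w,
    complex.Im w * cos phi < complex.Re w * sin phi & r < complex.Re w]].

(** The sector is an intersection of three open half-planes. *)
Lemma cvxset_sector (R : realType) (phi r : R) : cvxset (sector phi r).
Proof.
move=> [x y] [x' y'] s [/= a b c] [/= a' b' c'] /andP[s0 s1].
rewrite /sector /= !(mul0r, subr0, addr0).
(* Strictness of the combined inequality is drawn from the weight [s] of the second point, which
   must be positive. *)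
have [->|sn0] := eqVneq s 0; first by rewrite !mul0r !addr0.
have {}s0 : 0 < s by rewrite lt_neqAle eq_sym sn0.
have cvx (p q p' q' : R) : p < q -> p' < q' ->
    p + s * (p' - p) < q + s * (q' - q).
  move=> pq pq'.
  have -> : p + s * (p' - p) = (1 - s) * p + s * p' by ring.
  have -> : q + s * (q' - q) = (1 - s) * q + s * q' by ring.
  by rewrite ler_ltD // ?ltr_pM2l // ler_wpM2l ?subr_ge0 // ltW.
split.
- by have := cvx _ _ _ _ a a'; rewrite subrr mulr0 addr0.
- have := cvx _ _ _ _ b b'; congr (_ < _); ring.
- by have := cvx _ _ _ _ c c'; rewrite subrr mulr0 addr0.
Qed.

Lemma upper_side_sector (R : realType) (phi r x : R) : 0 < sin phi ->
  0 <= r -> r < x -> upper_side x%:C (sector phi r).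
Proof.
move=> sp r0 rx.
have hid : w @[w --> x%:C] --> x%:C by exact: cvg_id.
have /cvgC_ReIm[/= hR hI] := hid.
have h2 : complex.Re w * sin phi - complex.Im w * cos phi @[w --> x%:C] -->
    x * sin phi - 0 * cos phi.
  by apply: (@cvgB _ _ _ (nbhs x%:C)); apply: (@cvgM _ _ (nbhs x%:C)) => //; exact: cvg_cst.
have p2 : 0 < x * sin phi - 0 * cos phi.
  by rewrite mul0r subr0 mulr_gt0 // (le_lt_trans r0).
have H2 : \forall w \near x%:C, 0 < complex.Re w * sin phi - complex.Im w * cos phi.
  exact: (cvgr_gt _ h2).
have H1 : \forall w \near x%:C, r < complex.Re w by exact: (cvgr_gt _ hR).
change (\forall w \near x%:C, 0 < complex.Im w -> sector phi r w).
move: H1 H2; apply: filterS2 => w w1 w2 w3; split => //.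
by rewrite -subr_gt0.
Qed.

Lemma ray_dirP (R : realType) (phi1 phi2 : R) (k : 'I_10) :
  exists2 th : R, th \in [:: 0; phi1; phi2; pi - phi2; pi - phi1] &
    ray_dir phi1 phi2 k = cos th +i* sin th \/
    ray_dir phi1 phi2 k = - (cos th +i* sin th).
Proof.
have E (th : R) : cexp (0 +i* th) = cos th +i* sin th by rewrite /cexp expR0 mul1r.
case: k => m lt_m; rewrite /ray_dir /=; rewrite !E.
move: lt_m; do 5! (case: m => [_|m] /=; first by
  eexists; [|by left; reflexivity]; rewrite !inE eqxx ?orbT).
do 5! (case: m => [_|m] /=; first by
  eexists; [|by right; reflexivity]; rewrite !inE eqxx ?orbT).
by [].
Qed.

Lemma Sigma_MP (R : realType) (phi1 phi2 : R) (w : R[i]) :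
  Sigma_M phi1 phi2 w -> exists x th : R,
    [/\ 0 <= x, th \in [:: 0; phi1; phi2; pi - phi2; pi - phi1] &
        w = (x * cos th) +i* (x * sin th) \/ w = - ((x * cos th) +i* (x * sin th))].
Proof.
case=> k _ [x /= x0 <-]; have [th hth hd] := ray_dirP phi1 phi2 k.
exists x, th; split=> //.
case: hd => ->; [left|right; rewrite mulrN; congr (- _)];
  by apply: complexP; rewrite (ReM, ImM) /= mul0r ?subr0 ?addr0.
Qed.

(** A point x e^(i th) of the sector would satisfy x sin(th - phi1) < 0. The rays in the closed
    upper half-plane other than the real half-lines have phi1 <= th <= pi - phi1, where this sine is
    nonnegative, and all remaining rays have no point with positive imaginary part. *)
Lemma sector_notin_Sigma_M (R : realType) (phi1 phi2 r : R) :
  0 < phi1 -> phi1 < phi2 -> phi2 < pi / 2 ->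
  sector phi1 r `<=` ~` Sigma_M phi1 phi2.
Proof.
move=> p1 p12 p2 w [w1 w2 w3] /Sigma_MP[x [th [x0 hth hw]]].
have pi0 := pi_gt0 R.
have [thE|thr] : th = 0 \/ phi1 <= th <= pi - phi1.
  move: hth; rewrite !inE => /orP[/eqP ->|]; first by left.
  by move=> /or4P[] /eqP ->; right; apply/andP; split; lra.
  move: hw w1; rewrite thE sin0 mulr0; case=> -> /=; rewrite ?oppr0 ltxx //.
case/andP: thr => th1 th2.
have s0 : 0 <= sin th by apply: sin_ge0_pi; apply/andP; split; lra.
case: hw w1 w2 => -> /=; last first.
  by rewrite oppr_gt0 => /lt_geF; rewrite mulr_ge0.
move=> _; rewrite -subr_gt0.
have -> : x * cos th * sin phi1 - x * sin th * cos phi1 = - (x * sin (th - phi1)).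
  by rewrite sinB; ring.
rewrite oppr_gt0 => /lt_geF; rewrite mulr_ge0 // sin_ge0_pi //.
by apply/andP; split; lra.
Qed.

(** Every ray has a direction with nonzero cosine because phi2 < pi/2, so its only point with zero
    real part is the origin. *)
Lemma imaginary_notin_Sigma_M (R : realType) (phi1 phi2 y : R) :
  0 < phi1 -> phi1 < phi2 -> phi2 < pi / 2 -> 0 < y ->
  ~ Sigma_M phi1 phi2 ('i%C * y%:C).
Proof.
move=> p1 p12 p2 y0 /Sigma_MP[x [th [x0 hth hw]]].
have pi0 := pi_gt0 R.
have cth : cos th != 0.
  have c1 : 0 < cos phi1 by apply: cos_gt0_pihalf; apply/andP; split; lra.
  have c2 : 0 < cos phi2 by apply: cos_gt0_pihalf; apply/andP; split; lra.
  have cpi (a : R) : cos (pi - a) = - cos a by rewrite cosB cospi sinpi; ring.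
  move: hth; rewrite !inE => /orP[/eqP ->|]; first by rewrite cos0 oner_neq0.
  by move=> /or4P[] /eqP ->; rewrite ?cpi ?oppr_eq0 gt_eqF.
have hRe : x * cos th = 0.
  case: hw => /(congr1 (@complex.Re R)); rewrite ReM /= !(mul0r, mulr0, subr0).
    by move=> <-.
  by move=> /eqP; rewrite eq_sym oppr_eq0 => /eqP.
have {}x0 : x = 0 by move/eqP: hRe; rewrite mulf_eq0 (negbTE cth) orbF => /eqP.
move: hw; rewrite x0 !mul0r; case=> /(congr1 (@complex.Im R));
  rewrite ImM /= !(mul0r, mul1r, add0r) ?oppr0 => yE; move: y0; rewrite yE ltxx //.
Qed.

(** What the estimates use about [N] along a half-line parametrised by the modulus x. It is met both
    by the boundary values on the positive axis and by the restriction to the imaginary axis, so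
    that the two kernels share one estimate. *)
Definition path_data (R : realType) (N0 N1 : R -> 'M[R[i]]_4) (B r : R) : Prop :=
  [/\ 0 <= B, 1 <= r & forall x, r < x -> [/\ has_diffquo N0 x (N1 x),
    forall i j, cmod (N0 x i j - (i == j)%:R) <= B / x &
    forall i j, cmod (N1 x i j) <= B / x ^+ 2]].

Lemma le_cmod_vertical (R : realType) (x y : R) : 0 <= x -> x <= cmod (x +i* y).
Proof.
by move=> x0; apply: le_trans (Re_le_cmod _); rewrite /= ger0_norm.
Qed.

Lemma path_data_upper (R : realType) (phi1 phi2 : R) (N : R[i] -> 'M[R[i]]_4) :
  0 < phi1 -> phi1 < phi2 -> phi2 < pi / 2 ->
  inverse_power_expansion (~` Sigma_M phi1 phi2) N ->
  exists N0 N1 B r, path_data N0 N1 B r /\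
    forall x : R, r < x -> N w @[w --> upper_side x%:C] --> N0 x.
Proof.
move=> p1 p12 p2 /inverse_power_expansion_bounds[B [r [B0 r1 hN]]].
have pi0 := pi_gt0 R.
have sp : 0 < sin phi1 by apply: sin_gt0_pi; apply/andP; split; lra.
have hS z : sector phi1 r z -> (~` Sigma_M phi1 phi2) z /\ r < cmod z.
  move=> Sz; split; first exact: sector_notin_Sigma_M Sz.
  case: Sz => _ _ /lt_le_trans; apply.
  exact: le_trans (ler_norm _) (Re_le_cmod z).
pose N0 (x : R) : 'M[R[i]]_4 := \matrix_(i, j) upper_lim (fun w => N w i j : R[i]) x.
pose N1 (x : R) : 'M[R[i]]_4 :=
  \matrix_(i, j) upper_lim (fun w => derive1 N w i j : R[i]) x.
have cS := @cvxset_sector R phi1 r.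
have d1 i j w : sector phi1 r w -> has_cderiv (fun w => N w i j) w (derive1 N w i j).
  by case/hS => Dw rw; apply: has_cderiv_entry; case: (hN w Dw rw).
have d2 i j w : sector phi1 r w ->
    has_cderiv (fun w => derive1 N w i j) w (derive1 (derive1 N) w i j).
  by case/hS => Dw rw; apply: has_cderiv_entry; case: (hN w Dw rw).
(* As [r] is at least 1, the decaying bounds weaken to the constant [B], which can serve as a bound
   on the whole sector. *)
have c1 (w : R[i]) k : r < cmod w -> B / cmod w ^+ k <= B.
  move=> rw; rewrite ler_piMr // invf_le1 ?exprn_gt0 ?exprn_ege1 //; lra.
have b1 i j w : sector phi1 r w -> cmod (derive1 N w i j) <= B.
  by case/hS => Dw rw; case: (hN w Dw rw) => _ _ _ h _; apply: le_trans (h i j) (c1 _ _ rw).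
have b2 i j w : sector phi1 r w -> cmod (derive1 (derive1 N) w i j) <= B.
  by case/hS => Dw rw; case: (hN w Dw rw) => _ _ _ _ h; apply: le_trans (h i j) (c1 _ _ rw).
have uS x : r < x -> upper_side x%:C (sector phi1 r).
  by move=> rx; apply: upper_side_sector => //; lra.
have vert (x : R) : r < x -> \forall y \near (0 : R)^'+, sector phi1 r (x +i* y).
  by move=> rx; exact: near_upper_vertical (uS x rx).
have l0 x i j : r < x -> N w i j @[w --> upper_side x%:C] -->
    upper_lim (fun w => N w i j : R[i]) x.
  by move=> rx; exact: cvg_upper_lim cS (d1 i j) (b1 i j) (uS x rx).
have l1 x i j : r < x -> derive1 N w i j @[w --> upper_side x%:C] -->
    upper_lim (fun w => derive1 N w i j : R[i]) x.
  by move=> rx; exact: cvg_upper_lim cS (d2 i j) (b2 i j) (uS x rx).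
exists N0, N1, B, r; split; last first.
  by move=> x rx; apply/cvg_mxP => i j; rewrite mxE; exact: l0.
split=> // x rx; split=> [|i j|i j].
- apply/has_diffquo_mxP => i j.
  have -> : (fun v => N0 v i j) = upper_lim (fun w => N w i j : R[i]).
    by apply/funext => v; rewrite /N0 mxE.
  have -> : N1 x i j = upper_lim (fun w => derive1 N w i j : R[i]) x.
    by rewrite /N1 mxE.
  apply: (has_diffquo_upper_lim cS (d1 i j) (d2 i j) (b1 i j) (b2 i j)).
  have : \forall x' \near x, r < x' by exact: lt_nbhsr.
  by apply: filterS => x' /uS.
(* Above x the modulus is at least x, so the bound in [cmod (x +i* y)] is dominated by the bound in
   x, uniformly in y. *)
- have cc : (fun=> (i == j)%:R : R[i]) y @[y --> (0 : R)^'+] --> ((i == j)%:R : R[i]).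
    exact: cvg_cst.
  have h := cvg_comp _ _ (@cvg_upper_vertical R x) (l0 x i j rx).
  rewrite mxE; apply: (cvgC_cmod_le (cvgB h cc)).
  apply: filterS (vert x rx) => y /hS[Dw rw].
  have [_ _ h1 _ _] := hN _ Dw rw; apply: (le_trans (h1 i j)).
  rewrite ler_wpM2l // lef_pV2 ?posrE; [|lra|lra].
  by apply: le_cmod_vertical; lra.
- have h := cvg_comp _ _ (@cvg_upper_vertical R x) (l1 x i j rx).
  rewrite mxE; apply: (cvgC_cmod_le h).
  apply: filterS (vert x rx) => y /hS[Dw rw].
  have [_ _ _ h1 _] := hN _ Dw rw; apply: (le_trans (h1 i j)).
  have x0 : 0 <= x by lra.
  have yx := le_cmod_vertical y x0.
  rewrite ler_wpM2l // lef_pV2 ?posrE; [|apply: exprn_gt0; lra|apply: exprn_gt0; lra].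
  by rewrite lerXn2r ?nnegrE //; lra.
Qed.

Lemma scale_diffquo_i (R : realType) (a : R) (X : R[i]) :
  'i%C * ((a%:C * 'i%C)^-1 * X) = (a^-1)%:C *: X.
Proof.
have i0 : ('i%C : R[i]) != 0 by rewrite neq0Ci.
by rewrite invfM mulrA mulrCA divff // mulr1 fmorphV.
Qed.

Lemma path_data_imaginary (R : realType) (phi1 phi2 : R) (N : R[i] -> 'M[R[i]]_4) :
  0 < phi1 -> phi1 < phi2 -> phi2 < pi / 2 ->
  inverse_power_expansion (~` Sigma_M phi1 phi2) N ->
  exists N1 B r, path_data (fun x => N ('i%C * x%:C)) N1 B r.
Proof.
move=> p1 p12 p2 /inverse_power_expansion_bounds[B [r [B0 r1 hN]]].
(* The factor i is the chain rule for x -> i x; having modulus 1, it does not affect the bound. *)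
exists (fun x => 'i%C *: derive1 N ('i%C * x%:C)), B, r; split=> // x rx.
have x0 : 0 < x by lra.
have cx : cmod ('i%C * x%:C) = x by rewrite cmodM cmod_i cmodR mul1r gtr0_norm.
have D := imaginary_notin_Sigma_M p1 p12 p2 x0.
have hN' z c : (~` Sigma_M phi1 phi2) z -> cmod z = c -> r < c ->
    [/\ derivable N z 1, forall i j, cmod (N z i j - (i == j)%:R) <= B / c &
      forall i j, cmod (derive1 N z i j) <= B / c ^+ 2].
  by move=> Dz <- rz; have [? _ ? ? _] := hN z Dz rz.
have [d1 h0 h1] := hN' _ _ D cx rx.
split; [|exact: h0|]; last first.
  move=> i j; have -> : ('i%C *: derive1 N ('i%C * x%:C)) i j
      = 'i%C * derive1 N ('i%C * x%:C) i j by rewrite mxE.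
  by rewrite cmodM cmod_i mul1r; exact: h1.
apply/has_diffquo_mxP => i j; rewrite mxE /has_diffquo.
have i0 : ('i%C : R[i]) != 0 by rewrite neq0Ci.
have H := cvg_comp _ _ (@cvg_dnbhs_sub R x)
  (cvg_comp _ _ (cvg_dnbhs_dir i0) (@has_cderiv_entry _ _ _ _ i j d1)).
have ci : (fun=> 'i%C) y @[y --> x^'] --> ('i%C : R[i]) by exact: cvg_cst.
apply: (cvg_near_eq _ (cvgM ci H)); near=> v.
have vx : v - x != 0 by rewrite subr_eq0; near: v; exact: nbhs_dnbhs_neq.
rewrite /= -/((v - x)%:C); have -> : (v - x)%:C * 'i%C + 'i%C * x%:C = 'i%C * v%:C :> R[i].
  by rewrite rmorphB /=; ring.
exact: scale_diffquo_i.
Unshelve. all: by end_near. Qed.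

(** * The explicit factor and its logarithmic derivative *)

(** Split into two real derivatives so that the rules for [ln], [expR], [cos] and [sin] apply to the
    explicit factors. *)
Definition is_cderive1 (R : realType) (f : R -> R[i]) (x : R) (l : R[i]) : Prop :=
  is_derive x 1 (fun v => complex.Re (f v)) (complex.Re l) /\
  is_derive x 1 (fun v => complex.Im (f v)) (complex.Im l).

Lemma is_cderive1_diffquo (R : realType) (f : R -> R[i]) (x : R) (l : R[i]) :
  is_cderive1 f x l -> has_diffquo f x l.
Proof. by case; exact: has_diffquo_ReIm. Qed.

Lemma is_cderive1D (R : realType) (f g : R -> R[i]) (x : R) (l m : R[i]) :
  is_cderive1 f x l -> is_cderive1 g x m -> is_cderive1 (fun v => f v + g v) x (l + m).
Proof.
move=> [f1 f2] [g1 g2]; split.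
  rewrite ReD (_ : (fun v => _) = (fun v => complex.Re (f v)) + (fun v => complex.Re (g v))).
    exact: is_deriveD.
  by apply/funext => v; rewrite ReD.
rewrite ImD (_ : (fun v => _) = (fun v => complex.Im (f v)) + (fun v => complex.Im (g v))).
  exact: is_deriveD.
by apply/funext => v; rewrite ImD.
Qed.

Lemma is_cderive1Z (R : realType) (a : R[i]) (f : R -> R[i]) (x : R) (l : R[i]) :
  is_cderive1 f x l -> is_cderive1 (fun v => a * f v) x (a * l).
Proof.
move=> [f1 f2]; split.
  rewrite ReM (_ : (fun v => _) = complex.Re a \*: (fun v => complex.Re (f v))
     - complex.Im a \*: (fun v => complex.Im (f v))).
    by apply: is_deriveB; exact: is_deriveZ.
  by apply/funext => v; rewrite ReM.
rewrite ImM (_ : (fun v => _) = complex.Re a \*: (fun v => complex.Im (f v))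
     + complex.Im a \*: (fun v => complex.Re (f v))).
  by apply: is_deriveD; exact: is_deriveZ.
by apply/funext => v; rewrite ImM.
Qed.

Lemma is_cderive1N (R : realType) (f : R -> R[i]) (x : R) (l : R[i]) :
  is_cderive1 f x l -> is_cderive1 (fun v => - f v) x (- l).
Proof.
move=> /(is_cderive1Z (-1)); rewrite mulN1r.
by have -> : (fun v => -1 * f v) = (fun v => - f v) by apply/funext => v; rewrite mulN1r.
Qed.

Lemma is_cderive1_linear (R : realType) (a : R[i]) (x : R) :
  is_cderive1 (fun v => a * v%:C) x a.
Proof.
rewrite -[X in is_cderive1 _ _ X]mulr1; apply: is_cderive1Z.
by split=> /=; [exact: is_derive_id|exact: is_derive_cst].
Qed.

Lemma is_cderive1_cexp (R : realType) (f : R -> R[i]) (x : R) (l : R[i]) :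
  is_cderive1 f x l -> is_cderive1 (fun v => cexp (f v)) x (l * cexp (f x)).
Proof.
move=> [f1 f2].
have e1 : is_derive x 1 (fun v => expR (complex.Re (f v)))
    (expR (complex.Re (f x)) * complex.Re l).
  exact: (is_derive1_comp (is_derive_expR _) f1).
have e2 : is_derive x 1 (fun v => cos (complex.Im (f v)))
    (- sin (complex.Im (f x)) * complex.Im l).
  exact: (is_derive1_comp (is_derive_cos _) f2).
have e3 : is_derive x 1 (fun v => sin (complex.Im (f v)))
    (cos (complex.Im (f x)) * complex.Im l).
  exact: (is_derive1_comp (is_derive_sin _) f2).
split.
  rewrite (_ : (fun v => _) = (fun v => expR (complex.Re (f v))) * (fun v => cos (complex.Im (f v)))).
    eapply is_derive_eq; first exact: (is_deriveM e1 e2).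
    by rewrite /GRing.scale /= ReM Re_cexp Im_cexp; ring.
  by apply/funext => v; rewrite Re_cexp.
rewrite (_ : (fun v => _) = (fun v => expR (complex.Re (f v))) * (fun v => sin (complex.Im (f v)))).
  eapply is_derive_eq; first exact: (is_deriveM e1 e3).
  by rewrite /GRing.scale /= ImM Re_cexp Im_cexp; ring.
by apply/funext => v; rewrite Im_cexp.
Qed.

(* The boundary value of z |-> z^a along a ray of argument al, as a function of
   the modulus; al may be -pi. *)
Definition ray_pow (R : realType) (al a x : R) : R[i] :=
  cexp (a%:C * (ln x +i* al)).

Lemma cmod_ray_pow (R : realType) (al a x : R) : 0 < x ->
  cmod (ray_pow al a x) = x `^ a.
Proof.
by move=> x0; rewrite /ray_pow cmod_cexp ReM /= mul0r subr0 /powR gt_eqF.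
Qed.

Lemma ray_powD (R : realType) (al a b x : R) :
  ray_pow al (a + b) x = ray_pow al a x * ray_pow al b x.
Proof. by rewrite /ray_pow rmorphD /= mulrDl cexpD. Qed.

Lemma ray_pow0 (R : realType) (al x : R) : ray_pow al 0 x = 1.
Proof. by rewrite /ray_pow mul0r cexp0. Qed.

Lemma is_cderive1_ray_pow (R : realType) (al a x : R) : 0 < x ->
  is_cderive1 (ray_pow al a) x ((a / x)%:C * ray_pow al a x).
Proof.
move=> x0; apply: is_cderive1_cexp.
have -> : (a / x)%:C = a%:C * (x^-1)%:C :> R[i] by rewrite rmorphM.
apply: is_cderive1Z; split=> /=; last exact: is_derive_cst.
exact: is_derive1_ln.
Qed.

(** Both phases at once: [psi1] when [al] is the argument of z, and [psi2] when [al] is the argument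
    of -z. *)
Definition psi_path (R : realType) (al r s x : R) : R[i] :=
  (2 / 3 * r)%:C * ray_pow al (3 / 2) x + (2 * s)%:C * ray_pow al (1 / 2) x.

Definition dpsi_path (R : realType) (al r s x : R) : R[i] :=
  (r / x)%:C * ray_pow al (3 / 2) x + (s / x)%:C * ray_pow al (1 / 2) x.

Lemma is_cderive1_psi_path (R : realType) (al r s x : R) : 0 < x ->
  is_cderive1 (psi_path al r s) x (dpsi_path al r s x).
Proof.
move=> x0; have h a := is_cderive1_ray_pow al a x0.
have E (p q c : R) (z : R[i]) : p * q = c -> c%:C * z = p%:C * (q%:C * z).
  by move=> <-; rewrite rmorphM mulrA.
rewrite /dpsi_path (E (2 / 3 * r) (3 / 2 / x) (r / x)); last by field; rewrite gt_eqF.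
rewrite (E (2 * s) (1 / 2 / x) (s / x)); last by field; rewrite gt_eqF.
by apply: is_cderive1D; apply: is_cderive1Z.
Qed.

Definition B_path (R : realType) (al be x : R) : 'M[R[i]]_4 :=
  diag4 (ray_pow al (- (1 / 4)) x) (ray_pow be (- (1 / 4)) x)
        (ray_pow al (1 / 4) x) (ray_pow be (1 / 4) x).

(** Here [tau] is t times the direction of the half-line: t on the positive axis and t i on the
    imaginary one. As in [B_path], [al] belongs to -z and [be] to z. *)
Definition D_path (R : realType) (al be r1 r2 s1 s2 : R) (tau : R[i]) (x : R) :
    'M[R[i]]_4 :=
  diag4 (cexp (- psi_path al r2 s2 x + tau * x%:C))
        (cexp (- psi_path be r1 s1 x - tau * x%:C))
        (cexp (psi_path al r2 s2 x + tau * x%:C))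
        (cexp (psi_path be r1 s1 x - tau * x%:C)).

(** The exponents of the powers in [B], so that B' = B Q / x. *)
Definition Qmx (R : realType) : 'M[R[i]]_4 :=
  diag4 (- (1 / 4))%:C (- (1 / 4))%:C (1 / 4)%:C (1 / 4)%:C.

Definition Delta_path (R : realType) (al be r1 r2 s1 s2 : R) (tau : R[i]) (x : R) :
    'M[R[i]]_4 :=
  diag4 (- dpsi_path al r2 s2 x + tau) (- dpsi_path be r1 s1 x - tau)
        (dpsi_path al r2 s2 x + tau) (dpsi_path be r1 s1 x - tau).

Lemma diag4M (R : realType) (a b c d a' b' c' d' : R[i]) :
  diag4 a b c d *m diag4 a' b' c' d' = diag4 (a * a') (b * b') (c * c') (d * d').
Proof.
rewrite /diag4 mulmx_diag; congr diag_mx; apply/rowP => j; rewrite !mxE.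
by case: j => -[|[|[|[|]]]].
Qed.

Lemma diag4_1 (R : realType) : diag4 1 1 1 1 = 1%:M :> 'M[R[i]]_4.
Proof.
by apply/matrixP => i j; rewrite !mxE; congr (_ *+ _); case: i => -[|[|[|[|]]]].
Qed.

Lemma diag4Z (R : realType) (e a b c d : R[i]) :
  e *: diag4 a b c d = diag4 (e * a) (e * b) (e * c) (e * d).
Proof.
apply/matrixP => i j; rewrite !mxE mulrnAr; congr (_ *+ _).
by case: i => -[|[|[|[|]]]].
Qed.

Lemma has_diffquo_diag4 (R : realType) (a b c d : R -> R[i]) (x : R) a' b' c' d' :
  has_diffquo a x a' -> has_diffquo b x b' -> has_diffquo c x c' ->
  has_diffquo d x d' ->
  has_diffquo (fun v => diag4 (a v) (b v) (c v) (d v)) x (diag4 a' b' c' d').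
Proof.
move=> ha hb hc hd; apply/has_diffquo_mxP => i j.
have E p q r s : diag4 p q r s i j = [:: p; q; r; s]`_j *+ (i == j).
  by rewrite !mxE; case: eqP => // ->.
have -> : (fun v => diag4 (a v) (b v) (c v) (d v) i j) =
   (fun v => [:: a v; b v; c v; d v]`_j *+ (i == j)) by apply/funext => v; rewrite E.
have hk k : (k < 4)%N ->
    has_diffquo (fun v => [:: a v; b v; c v; d v]`_k) x [:: a'; b'; c'; d']`_k.
  move: k => [|[|[|[|k]]]] lt_k; last by exfalso; rewrite !ltnS ltn0 in lt_k.
  - exact: ha.
  - exact: hb.
  - exact: hc.
  - exact: hd.
rewrite E; case: (i == j); last exact: has_diffquo_cst.
exact: hk (ltn_ord j).
Qed.

Lemma has_diffquo_B_path (R : realType) (al be x : R) : 0 < x ->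
  has_diffquo (B_path al be) x ((x^-1)%:C *: (B_path al be x *m Qmx R)).
Proof.
move=> x0; rewrite /B_path /Qmx diag4M diag4Z.
have E a b : (x^-1)%:C * (a * b%:C) = (b / x)%:C * a :> R[i].
  by rewrite rmorphM /=; ring.
by apply: has_diffquo_diag4; rewrite E; apply: is_cderive1_diffquo;
  exact: is_cderive1_ray_pow.
Qed.

Lemma is_cderive1_diffquo_cexp (R : realType) (f : R -> R[i]) (x : R) (l : R[i]) :
  is_cderive1 f x l -> has_diffquo (fun v => cexp (f v)) x (cexp (f x) * l).
Proof.
by move=> hf; rewrite mulrC; apply: is_cderive1_diffquo; exact: is_cderive1_cexp.
Qed.

Lemma has_diffquo_D_path (R : realType) (al be r1 r2 s1 s2 : R) (tau : R[i]) (x : R) :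
  0 < x ->
  has_diffquo (D_path al be r1 r2 s1 s2 tau) x
   (D_path al be r1 r2 s1 s2 tau x *m Delta_path al be r1 r2 s1 s2 tau x).
Proof.
move=> x0; rewrite /D_path /Delta_path diag4M.
have h1 al' r s := is_cderive1_psi_path al' r s x0.
have h2 := is_cderive1_linear tau x; have h3 := is_cderive1N h2.
apply: has_diffquo_diag4.
- apply: (@is_cderive1_diffquo_cexp _ (fun v => - psi_path al r2 s2 v + tau * v%:C)).
  by apply: is_cderive1D h2; apply: is_cderive1N; exact: h1.
- apply: (@is_cderive1_diffquo_cexp _ (fun v => - psi_path be r1 s1 v - tau * v%:C)).
  by apply: is_cderive1D h3; apply: is_cderive1N; exact: h1.
- apply: (@is_cderive1_diffquo_cexp _ (fun v => psi_path al r2 s2 v + tau * v%:C)).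
  by apply: is_cderive1D h2; exact: h1.
- apply: (@is_cderive1_diffquo_cexp _ (fun v => psi_path be r1 s1 v - tau * v%:C)).
  by apply: is_cderive1D h3; exact: h1.
Qed.

(** * The constant matrix A and the logarithmic derivative of P *)

Definition Ainv (R : realType) : 'M[R[i]]_4 :=
  (Num.sqrt 2)^-1%:C *: mx4 [:: [::   1;   0; 'i%C;  0];
                                [::   0;   1;    0; - 'i%C];
                                [:: 'i%C;  0;    1;  0];
                                [::   0;  - 'i%C;    0;  1]].

(** The conjugate A^-1 Q A. Its zero diagonal means that the powers in [B] act only through the
    pairs (1,3) and (2,4). *)
Definition AQA (R : realType) : 'M[R[i]]_4 :=
  (1 / 4)%:C *: mx4 [:: [::   0;   0; 'i%C;  0];
                                [::   0;   0;    0; - 'i%C];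
                                [:: - 'i%C;  0;    0;  0];
                                [::   0;  'i%C;    0;  0]].

Lemma mulmx_Ainv_Amx (R : realType) : Ainv R *m Amx R = 1%:M.
Proof.
rewrite /Ainv /Amx -scalemxAl -scalemxAr scalerA -rmorphM.
have -> : (Num.sqrt 2)^-1 * (Num.sqrt 2)^-1 = 2^-1 :> R.
  by rewrite -invfM -expr2 sqr_sqrtr.
apply/matrixP => i j; rewrite !mxE !big_ord_recl big_ord0 !mxE.
by case: i => -[|[|[|[|//]]]] ?; case: j => -[|[|[|[|//]]]] ?;
  apply: complexP => /=; field.
Qed.

Lemma mulmx_Qmx_Amx (R : realType) : Qmx R *m Amx R = Amx R *m AQA R.
Proof.
rewrite /Qmx /Amx /AQA -scalemxAr -scalemxAl; congr (_ *: _).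
apply/matrixP => i j; rewrite !mxE !big_ord_recl !big_ord0 !mxE.
by case: i => -[|[|[|[|//]]]] ?; case: j => -[|[|[|[|//]]]] ?;
  apply: complexP => /=; field.
Qed.

Lemma normmx_Amx_Ainv (R : realType) : `|Amx R| <= 1 /\ `|Ainv R| <= 1.
Proof.
have s1 : `|(Num.sqrt 2)^-1%:C : R[i]| <= 1.
  rewrite normCE cmodR ger0_norm ?invr_ge0 ?sqrtr_ge0 // lecR.
  rewrite invf_le1 ?sqrtr_gt0 // -{1}(sqrtr1 R) ler_wsqrtr // ler1n //.
have i1 : `|'i%C : R[i]| <= 1 by rewrite normCE cmod_i.
by split; rewrite normrZ; apply: mulr_ile1 => //; apply: normmx_le => // i j;
  rewrite !mxE; case: i => -[|[|[|[|//]]]] ?; case: j => -[|[|[|[|//]]]] ? /=;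
  rewrite ?normrN ?normr0 ?normr1.
Qed.

Lemma normmx_diag4 (R : realType) (a b c d : R[i]) (e : R) :
  cmod a <= e -> cmod b <= e -> cmod c <= e -> cmod d <= e ->
  `|diag4 a b c d| <= e%:C.
Proof.
move=> ha hb hc hd.
have e0 : 0 <= e by apply: le_trans ha; exact: cmod_ge0.
apply: normmx_le => [|i j]; first by rewrite lecR.
rewrite !mxE; case: (i == j); last by rewrite mulr0n normr0 lecR.
by rewrite mulr1n normCE lecR; case: i => -[|[|[|[|//]]]].
Qed.

Definition Binv_path (R : realType) (al be x : R) : 'M[R[i]]_4 :=
  diag4 (ray_pow al (1 / 4) x) (ray_pow be (1 / 4) x)
        (ray_pow al (- (1 / 4)) x) (ray_pow be (- (1 / 4)) x).

Lemma mulmx_Binv_B (R : realType) (al be x : R) :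
  Binv_path al be x *m B_path al be x = 1%:M.
Proof. by rewrite diag4M -!ray_powD subrr addNr !ray_pow0 diag4_1. Qed.

Lemma normmx_B_Binv (R : realType) (al be x : R) : 1 <= x ->
  `|B_path al be x| <= (x `^ (1 / 4))%:C /\
  `|Binv_path al be x| <= (x `^ (1 / 4))%:C.
Proof.
move=> x1; have x0 : 0 < x by lra.
by split; apply: normmx_diag4; rewrite cmod_ray_pow // ler_powR //; lra.
Qed.

Definition Dinv_path (R : realType) (al be r1 r2 s1 s2 : R) (tau : R[i]) (x : R) :
    'M[R[i]]_4 :=
  diag4 (cexp (- (- psi_path al r2 s2 x + tau * x%:C)))
        (cexp (- (- psi_path be r1 s1 x - tau * x%:C)))
        (cexp (- (psi_path al r2 s2 x + tau * x%:C)))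
        (cexp (- (psi_path be r1 s1 x - tau * x%:C))).

Lemma mulmx_Dinv_D (R : realType) (al be r1 r2 s1 s2 : R) (tau : R[i]) (x : R) :
  Dinv_path al be r1 r2 s1 s2 tau x *m D_path al be r1 r2 s1 s2 tau x = 1%:M.
Proof. by rewrite diag4M !cexpN diag4_1. Qed.

(** In a product the logarithmic derivative of the left factor gets conjugated by the right one. It
    is applied to [B A] and [D]. *)
Lemma has_diffquo_mulmx_log (R : realType) n (f g : R -> 'M[R[i]]_n) (x : R)
    (a b : 'M[R[i]]_n) :
  has_diffquo f x (f x *m a) -> has_diffquo g x (g x *m b) ->
  forall gi, g x *m gi = 1%:M ->
  has_diffquo (fun v => f v *m g v) x (f x *m g x *m (gi *m a *m g x + b)).
Proof.
move=> hf hg gi E.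
have -> : f x *m g x *m (gi *m a *m g x + b) = f x *m a *m g x + f x *m (g x *m b).
  by rewrite mulmxDr !mulmxA -(mulmxA (f x)) E mulmx1.
exact: has_diffquo_mulmx.
Qed.

Definition P_path (R : realType) (al be r1 r2 s1 s2 : R) (tau : R[i]) (x : R) :
    'M[R[i]]_4 :=
  B_path al be x *m Amx R *m D_path al be r1 r2 s1 s2 tau x.

Definition Pinv_path (R : realType) (al be r1 r2 s1 s2 : R) (tau : R[i]) (x : R) :
    'M[R[i]]_4 :=
  Dinv_path al be r1 r2 s1 s2 tau x *m Ainv R *m Binv_path al be x.

Lemma mulmx_Pinv_P (R : realType) (al be r1 r2 s1 s2 : R) (tau : R[i]) (x : R) :
  Pinv_path al be r1 r2 s1 s2 tau x *m P_path al be r1 r2 s1 s2 tau x = 1%:M.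
Proof.
rewrite /Pinv_path /P_path -!mulmxA (mulmxA (Binv_path _ _ _)) mulmx_Binv_B mul1mx.
by rewrite (mulmxA (Ainv R)) mulmx_Ainv_Amx mul1mx mulmx_Dinv_D.
Qed.

(** The logarithmic derivative P^-1 P' of the explicit factor. *)
Definition W_path (R : realType) (al be r1 r2 s1 s2 : R) (tau : R[i]) (x : R) :
    'M[R[i]]_4 :=
  Dinv_path al be r1 r2 s1 s2 tau x *m ((x^-1)%:C *: AQA R)
    *m D_path al be r1 r2 s1 s2 tau x + Delta_path al be r1 r2 s1 s2 tau x.

Lemma has_diffquo_P_path (R : realType) (al be r1 r2 s1 s2 : R) (tau : R[i]) (x : R) :
  0 < x -> has_diffquo (P_path al be r1 r2 s1 s2 tau) x
    (P_path al be r1 r2 s1 s2 tau x *m W_path al be r1 r2 s1 s2 tau x).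
Proof.
move=> x0; apply: has_diffquo_mulmx_log.
- have := has_diffquo_mulmx (@has_diffquo_B_path _ al be x x0) (@has_diffquo_cst _ _ x (Amx R)).
  suff -> : ((x^-1)%:C *: (B_path al be x *m Qmx R)) *m Amx R + B_path al be x *m 0
    = B_path al be x *m Amx R *m ((x^-1)%:C *: AQA R) by exact.
  rewrite mulmx0 addr0 -(scalemxAl _ (B_path al be x *m _)) -(scalemxAr _ _ (AQA R)).
  congr (_ *: _).
  by rewrite -!mulmxA mulmx_Qmx_Amx.
- exact: has_diffquo_D_path.
- by apply: mulmx1C; exact: mulmx_Dinv_D.
Qed.

Lemma cvg_inv_pinfty (R : realType) : x^-1 @[x --> +oo] --> (0 : R).
Proof.
apply/(@gtr0_cvgV0 _ _ _ _ (fun x : R => x)) => //; exact: nbhs_pinfty_gt.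
Qed.

(** [N0] tends to the identity and inversion is continuous there; the identity has norm 1, and the
    bound 2 leaves room for an error of 1. *)
Lemma path_data_invmx (R : realType) (N0 N1 : R -> 'M[R[i]]_4) (B r : R) :
  path_data N0 N1 B r ->
  \forall x \near +oo, N0 x \in unitmx /\ `|invmx (N0 x)| <= 2%:C.
Proof.
move=> [B0 r1 h].
have c1 : N0 x @[x --> +oo] --> (1%:M : 'M[R[i]]_4).
  apply/cvg_mxP => i j; apply/cvgC_cmod => e e0.
  have hB : B * x^-1 @[x --> +oo] --> B * 0.
    by apply: cvgM; [exact: cvg_cst|exact: cvg_inv_pinfty].
  have : \forall x \near +oo, B * x^-1 < e by apply: (cvgr_lt _ hB); rewrite mulr0.
  have := nbhs_pinfty_gt (num_real r).
  apply: filterS2 => x /h[_ hx _] xe.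
  by rewrite cmodB mxE; apply: le_lt_trans xe.
have u1 : (1%:M : 'M[R[i]]_4) \in unitmx by exact: unitmx1.
have near_u : \forall x \near +oo, N0 x \in unitmx by exact: near_unitmx c1 u1.
have : \forall x \near +oo, `|invmx 1%:M - invmx (N0 x)| < 1.
  by apply: cvgr_dist_lt; [exact: cvg_invmx|exact: ltr01].
move: near_u; apply: filterS2 => x h2 h1; split=> //.
rewrite -(subrKC (invmx 1%:M) (invmx (N0 x))).
apply: (le_trans (ler_normD _ _)).
have -> : 2%:C = 1 + 1 :> R[i] by apply: complexP => /=; ring.
rewrite lerD //; last by rewrite distrC ltW.
rewrite invmx1; apply: normmx_le => // i j; rewrite mxE.
by case: (i == j); rewrite ?normr1 ?normr0.
Qed.

Lemma normmx_mulmx4 (R : realType) m n (A : 'M[R[i]]_(m, 4)) (B : 'M[R[i]]_(4, n))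
    (a b : R) : `|A| <= a%:C -> `|B| <= b%:C -> `|A *m B| <= (4 * a * b)%:C.
Proof.
move=> hA hB; apply: (le_trans (normmxM A B)).
have -> : (4 * a * b)%:C = 4%:R * a%:C * b%:C :> R[i] by rewrite !rmorphM /= rmorph_nat.
by rewrite ler_pM ?mulr_ge0 // ler_pM.
Qed.

(** The function [rho] measures the exponentials, which may grow or decay along the half-line: [l]
    times the inverse of [D] is at most 1/rho and [D] times [c] at most rho, so they cancel and only
    powers of x remain. *)
Lemma path_estimate (R : realType) (N0 N1 : R -> 'M[R[i]]_4) (B r : R)
    (al be r1 r2 s1 s2 : R) (tau : R[i]) (l : 'rV[R[i]]_4) (c : 'cV[R[i]]_4)
    (rho : R -> R) :
  path_data N0 N1 B r ->
  (forall x, 0 < x -> 0 < rho x /\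
    `|l *m Dinv_path al be r1 r2 s1 s2 tau x| <= ((rho x)^-1)%:C /\
    `|D_path al be r1 r2 s1 s2 tau x *m c| <= (rho x)%:C) ->
  exists k : R, \forall x \near +oo,
    cmod ((l *m (Pinv_path al be r1 r2 s1 s2 tau x *m (invmx (N0 x) *m N1 x)
            *m P_path al be r1 r2 s1 s2 tau x) *m c) 0 0) <= k * x `^ (- (3 / 2)).
Proof.
(* Seven matrix products with inner dimension 4, the bound 2 for the inverse of [N0], and [B] from
   [N1]. *)
move=> hN hl; exists (4 ^+ 7 * 2 * B).
have h1 := path_data_invmx hN; have [B0 r_1 h2] := hN.
have := nbhs_pinfty_gt (num_real r); move: h1.
apply: filterS2 => x [Nu Ni] rx.
have [_ _ hN1] := h2 x rx; have x0 : 0 < x by lra.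
have [rho0 [hl1 hl2]] := hl x x0.
have [nB nBi] := @normmx_B_Binv R al be x ltac:(lra).
have [nA nAi] := normmx_Amx_Ainv R.
have nN1 : `|N1 x| <= (B / x ^+ 2)%:C.
  apply: normmx_le => [|i j]; first by rewrite lecR divr_ge0 // exprn_ge0 // ltW.
  by rewrite normCE lecR.
have n1 := normmx_mulmx4 hl1 nAi.
have n2 := normmx_mulmx4 n1 nBi.
have n3 := normmx_mulmx4 n2 (normmx_mulmx4 Ni nN1).
have n4 := normmx_mulmx4 n3 nB.
have n5 := normmx_mulmx4 n4 nA.
have n6 := normmx_mulmx4 n5 hl2.
rewrite /Pinv_path /P_path !mulmxA in n6 *.
rewrite -lecR -normCE; apply: (le_trans (normmx_entry _ 0 0)); apply: (le_trans n6).
rewrite lecR.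
have -> : - (3 / 2) = 1 / 4 + 1 / 4 + (- 2) :> R by field.
have xn : (x != 0) by rewrite gt_eqF.
rewrite !powRD ?xn ?implybT // powR_invn ?(ltW x0) //.
rewrite le_eqVlt; apply/orP; left; apply/eqP.
by field; rewrite xn gt_eqF.
Qed.

(** * Diagonal values of the kernels *)

(** As l c = 0, subtracting l P(v)^-1 P(v) c does not change the numerator of the kernel and turns
    the expression into a difference quotient of [P]. *)
Lemma kernel_diagE (R : realType) (l : 'rV[R[i]]_4) (c : 'cV[R[i]]_4)
    (P : R -> 'M[R[i]]_4) (u : R) (P' : 'M[R[i]]_4) :
  has_diffquo P u P' -> P u \in unitmx -> l *m c = 0 ->
  Defs.kernel l c P u u
  = (2 * pi%:C * 'i%C)^-1 * (l *m invmx (P u) *m P' *m c) 0 0.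
Proof.
move=> dP uP lc; rewrite /Defs.kernel eqxx; apply: cvg_lim; first exact: norm_hausdorff.
have cP := has_diffquo_cvg dP.
have near_u : \forall v \near u^', P v \in unitmx by exact: near_unitmx cP uP.
have H : l *m invmx (P v) *m (((v - u)^-1)%:C *: (P v - P u)) *m c @[v --> u^'] -->
    l *m invmx (P u) *m P' *m c.
  apply: cvg_mulmx; last exact: cvg_cst.
  apply: cvg_mulmx; last exact: dP.
  by apply: cvg_mulmx; [exact: cvg_cst|exact: cvg_invmx].
move/cvg_mxP: H => /(_ 0 0) H.
have H2 : (2 * pi%:C * 'i%C)^-1 * (l *m invmx (P v) *m
     (((v - u)^-1)%:C *: (P v - P u)) *m c) 0 0 @[v --> u^'] -->
    (2 * pi%:C * 'i%C)^-1 * (l *m invmx (P u) *m P' *m c) 0 0.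
  by apply: cvgM; [exact: cvg_cst|exact: H].
apply: (cvg_near_eq _ H2); move: near_u; apply: filterS => v uv.
set k0 := 2 * pi%:C * 'i%C; rewrite [in RHS]invfM -mulrA; congr (_ * _).
rewrite -scalemxAr -scalemxAl mxE mulmxBr mulmxBl -[l *m _ *m P v]mulmxA mulVmx //.
rewrite mulmx1 lc sub0r mxE mulrN -mulNr; congr (_ * _).
by rewrite -fmorphV -rmorphN /= -invrN opprB.
Qed.

Lemma mx11_trmx (R : realType) (A : 'M[R[i]]_1) : A^T = A.
Proof. by apply/matrixP => i j; rewrite mxE !ord1. Qed.

(** With P = M^-T S and S an involution, l P(v)^-1 P(u) c is a scalar, equal to its transpose (S
    c)^T M(u)^-1 M(v) (l S)^T. The roles of u and v are exchanged, which produces the minus sign. *)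
Lemma kernel_dual_diagE (R : realType) (l : 'rV[R[i]]_4) (c : 'cV[R[i]]_4)
    (P M : R -> 'M[R[i]]_4) (S M' : 'M[R[i]]_4) (u : R) :
  (\forall v \near u, P v = (invmx (M v))^T *m S) -> S *m S = 1%:M ->
  has_diffquo M u M' -> M u \in unitmx -> l *m c = 0 ->
  Defs.kernel l c P u u
  = - (2 * pi%:C * 'i%C)^-1
    * ((S *m c)^T *m invmx (M u) *m M' *m (l *m S)^T) 0 0.
Proof.
move=> PE SS dM uM lc; rewrite /Defs.kernel eqxx; apply: cvg_lim; first exact: norm_hausdorff.
have cM := has_diffquo_cvg dM.
have near_u : \forall v \near u^', M v \in unitmx by exact: near_unitmx cM uM.
have Pu := nbhs_singleton PE.
have PE' : \forall v \near u^', P v = (invmx (M v))^T *m S.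
  change (\forall v \near u, v != u -> P v = (invmx (M v))^T *m S).
  by apply: filterS PE => v ? _.
have H : (S *m c)^T *m invmx (M u) *m (((v - u)^-1)%:C *: (M v - M u)) *m (l *m S)^T
    @[v --> u^'] --> (S *m c)^T *m invmx (M u) *m M' *m (l *m S)^T.
  apply: cvg_mulmx; last exact: cvg_cst.
  by apply: cvg_mulmx; [exact: cvg_cst|exact: dM].
move/cvg_mxP: H => /(_ 0 0) H.
have H2 : - (2 * pi%:C * 'i%C)^-1 * ((S *m c)^T *m invmx (M u) *m
      (((v - u)^-1)%:C *: (M v - M u)) *m (l *m S)^T) 0 0 @[v --> u^'] -->
    - (2 * pi%:C * 'i%C)^-1 * ((S *m c)^T *m invmx (M u) *m M' *m (l *m S)^T) 0 0.
  by apply: cvgM; [exact: cvg_cst|exact: H].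
apply: (cvg_near_eq _ H2); move: near_u PE'; apply: filterS2 => v uv Pv.
have iv : invmx (P v) = S *m (M v)^T.
  have E : S *m (M v)^T *m P v = 1%:M.
    by rewrite Pv mulmxA -(mulmxA S) -trmx_mul mulVmx // trmx1 mulmx1.
  have uP : P v \in unitmx by case/mulmx1_unit: E.
  by apply: (can_inj (mulmxK uP)); rewrite mulVmx.
set k0 := 2 * pi%:C * 'i%C.
rewrite iv Pu [in RHS]invfM mulNr -mulrN -[in RHS]mulrA; congr (_ * _).
rewrite -scalemxAr -scalemxAl mxE mulmxBr mulmxBl -[_ *m _ *m M u]mulmxA mulVmx //.
rewrite mulmx1.
have -> : (S *m c)^T *m (l *m S)^T = 0.
  by rewrite -trmx_mul -mulmxA (mulmxA S) SS mul1mx lc trmx0.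
rewrite subr0 -mulNr; congr (_ * _).
  by rewrite -fmorphV -rmorphN /= -invrN opprB.
rewrite -[in RHS](mx11_trmx (l *m _ *m _ *m _)) !trmx_mul !trmxK !mulmxA.
by [].
Qed.

(** * Boundary values of the explicit factor on the positive axis *)

Lemma cvg_cmod (R : realType) (T : Type) (F : set_system T) {FF : Filter F}
    (f : T -> R[i]) (l : R[i]) :
  f x @[x --> F] --> l -> cmod (f x) @[x --> F] --> cmod l.
Proof.
move=> /cvgC_cmod h; apply/cvgrPdist_lt => e e0; move: (h e e0).
apply: filterS => x; apply: le_lt_trans; rewrite ler_norml.
have := ler_cmodD (l - f x) (f x); rewrite subrK => h1.
have := ler_cmodD (f x - l) l; rewrite subrK cmodB => h2.
by apply/andP; split; lra.
Qed.

(** Continuity of [acos] at the endpoint 1 of its domain: the cosine decreases on [0, pi], so acos y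
    < d as soon as y > cos d. *)
Lemma cvg_acos1 (R : realType) (T : Type) (F : set_system T) {FF : Filter F}
    (f : T -> R) :
  f x @[x --> F] --> (1 : R) -> (\forall x \near F, -1 <= f x <= 1) ->
  acos (f x) @[x --> F] --> (0 : R).
Proof.
move=> h fb; apply/cvgrPdist_lt => e e0.
have pi0 := pi_gt0 R.
pose d := Num.min e pi.
have d0 : 0 < d by rewrite lt_min e0.
have dpi : d <= pi by rewrite ge_min lexx orbT.
have cd : cos d < 1.
  by rewrite -cos0 ltr_cos ?in_itv /= ?lexx ?(ltW pi0) ?(ltW d0).
have hc : \forall x \near F, cos d < f x by exact: (cvgr_gt _ h).
move: fb hc; apply: filterS2 => x fx cfx; rewrite sub0r normrN.
rewrite ger0_norm ?acos_ge0 //; apply: (@lt_le_trans _ _ d); last by rewrite ge_min lexx.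
rewrite -ltr_cos ?in_itv /= ?acos_ge0 ?acos_lepi ?(ltW d0) //.
by rewrite acosK // in_itv.
Qed.

Lemma Re_div_cmod_bound (R : realType) (z : R[i]) :
  -1 <= complex.Re z / cmod z <= 1.
Proof.
rewrite -ler_norml normrM normfV (ger0_norm (cmod_ge0 z)).
have [->|z0] := eqVneq (cmod z) 0; first by rewrite invr0 mulr0.
by rewrite ler_pdivrMr ?mul1r ?Re_le_cmod // lt_neqAle eq_sym z0 cmod_ge0.
Qed.

Lemma cvg_diag4 (R : realType) (T : Type) (F : set_system T) {FF : Filter F}
    (a b c d : T -> R[i]) (a' b' c' d' : R[i]) :
  a y @[y --> F] --> a' -> b y @[y --> F] --> b' ->
  c y @[y --> F] --> c' -> d y @[y --> F] --> d' ->
  diag4 (a y) (b y) (c y) (d y) @[y --> F] --> diag4 a' b' c' d'.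
Proof.
move=> ha hb hc hd; apply/cvg_mxP => i j.
have E p q r s : diag4 p q r s i j = [:: p; q; r; s]`_j *+ (i == j) :> R[i].
  by rewrite !mxE; case: eqP => // ->.
rewrite E; under eq_cvg do rewrite E.
case: (i == j); last exact: cvg_cst.
have hk k : (k < 4)%N ->
    [:: a y; b y; c y; d y]`_k @[y --> F] --> [:: a'; b'; c'; d']`_k.
  move: k => [|[|[|[|k]]]] lt_k; last by exfalso; rewrite !ltnS ltn0 in lt_k.
  - exact: ha.
  - exact: hb.
  - exact: hc.
  - exact: hd.
exact: hk (ltn_ord j).
Qed.

Section UpperLimits.
Variables (R : realType) (x : R).
Hypothesis x0 : 0 < x.

Lemma cvg_upper_id : w @[w --> upper_side x%:C] --> x%:C.
Proof. exact: cvg_within. Qed.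

Lemma near_upper_Im : \forall w \near upper_side x%:C, 0 < complex.Im w.
Proof.
change (\forall w \near x%:C, 0 < complex.Im w -> 0 < complex.Im w).
by apply: filterE => w.
Qed.

Lemma cvg_upper_cos : complex.Re w / cmod w @[w --> upper_side x%:C] --> (1 : R).
Proof.
have h := cvg_upper_id; have /cvgC_ReIm[/= hR _] := h.
have hc := cvg_cmod h; rewrite cmodR gtr0_norm // in hc.
have -> : (1 : R) = x * x^-1 by rewrite divff ?gt_eqF.
have hV : (cmod w)^-1 @[w --> upper_side x%:C] --> x^-1.
  by apply: cvgV; [rewrite gt_eqF|exact: hc].
by apply: cvgM; [exact: hR|exact: hV].
Qed.

Lemma cvg_upper_carg : carg w @[w --> upper_side x%:C] --> (0 : R).
Proof.
have bnd : \forall w \near upper_side x%:C, -1 <= complex.Re w / cmod w <= 1.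
  by apply: filterE => w; exact: Re_div_cmod_bound.
have h : acos (complex.Re w / cmod w) @[w --> upper_side x%:C] --> (0 : R).
  by apply: cvg_acos1 bnd; exact: cvg_upper_cos.
apply: (cvg_near_eq _ h); move: near_upper_Im; apply: filterS => w w0.
by rewrite /carg ltW.
Qed.

(** When w lies above the positive axis, -w lies below the cut, so its argument tends to -pi,
    although [carg] equals pi on the cut itself. *)
Lemma cvg_upper_cargN : carg (- w) @[w --> upper_side x%:C] --> - (pi : R).
Proof.
have bnd : \forall w \near upper_side x%:C, -1 <= complex.Re w / cmod w <= 1.
  by apply: filterE => w; exact: Re_div_cmod_bound.
have h : acos (complex.Re w / cmod w) @[w --> upper_side x%:C] --> (0 : R).
  by apply: cvg_acos1 bnd; exact: cvg_upper_cos.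
have hpi : (pi : R) @[_ --> upper_side x%:C] --> (pi : R) by exact: cvg_cst.
have h2 : acos (complex.Re w / cmod w) - pi @[w --> upper_side x%:C] --> - (pi : R).
  by rewrite -[X in _ --> X]sub0r; exact: (cvgB h hpi).
apply: (cvg_near_eq _ h2); move: near_upper_Im; apply: filterS => w w0.
rewrite /carg ImN leNgt oppr_lt0 w0 /= ReN cmodN mulNr acosN ?Re_div_cmod_bound //.
by rewrite opprB.
Qed.

Lemma cvg_upper_ln : ln (cmod w) @[w --> upper_side x%:C] --> ln x.
Proof.
have hc : cmod w @[w --> upper_side x%:C] --> x.
  by rewrite -{2}(gtr0_norm x0) -cmodR; apply: cvg_cmod; exact: cvg_upper_id.
exact: (cvg_comp _ _ hc (continuous_ln x0)).
Qed.

Lemma cvg_upper_cpow (a : R) : cpow w a @[w --> upper_side x%:C] --> ray_pow 0 a x.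
Proof.
apply: cvg_cexp; apply: cvgM; first exact: cvg_cst.
by apply/cvgC_ReIm; split=> /=; [exact: cvg_upper_ln|exact: cvg_upper_carg].
Qed.

Lemma cvg_upper_cpowN (a : R) :
  cpow (- w) a @[w --> upper_side x%:C] --> ray_pow (- pi) a x.
Proof.
apply: cvg_cexp; apply: cvgM; first exact: cvg_cst.
apply/cvgC_ReIm; split=> /=; last exact: cvg_upper_cargN.
by under eq_cvg do rewrite cmodN; exact: cvg_upper_ln.
Qed.

Lemma cvg_upper_psi2 (r s : R) :
  psi2 r s w @[w --> upper_side x%:C] --> psi_path (- pi) r s x.
Proof.
by apply: cvgD; (apply: cvgM; [exact: cvg_cst|exact: cvg_upper_cpowN]).
Qed.

Lemma cvg_upper_psi1 (r s : R) :
  psi1 r s w @[w --> upper_side x%:C] --> psi_path 0 r s x.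
Proof.
by apply: cvgD; (apply: cvgM; [exact: cvg_cst|exact: cvg_upper_cpow]).
Qed.

Lemma cvg_upper_Bmx : Bmx w @[w --> upper_side x%:C] --> B_path (- pi) 0 x.
Proof.
apply: cvg_diag4; [exact: cvg_upper_cpowN|exact: cvg_upper_cpow|
  exact: cvg_upper_cpowN|exact: cvg_upper_cpow].
Qed.

Lemma cvg_upper_Dmx (r1 r2 s1 s2 t : R) :
  Dmx r1 r2 s1 s2 t w @[w --> upper_side x%:C] -->
  D_path (- pi) 0 r1 r2 s1 s2 t%:C x.
Proof.
have ht : t%:C * w @[w --> upper_side x%:C] --> t%:C * x%:C.
  by apply: cvgM; [exact: cvg_cst|exact: cvg_upper_id].
apply: cvg_diag4; apply: cvg_cexp.
- by apply: cvgD ht; apply: cvgN; exact: cvg_upper_psi2.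
- by apply: cvgB ht; apply: cvgN; exact: cvg_upper_psi1.
- by apply: cvgD ht; exact: cvg_upper_psi2.
- by apply: cvgB ht; exact: cvg_upper_psi1.
Qed.

End UpperLimits.

(** * Evaluation of the explicit term *)

Lemma row_mul_diag4 (R : realType) (a1 a2 a3 a4 e1 e2 e3 e4 : R[i]) :
  (\row_(j < 4) [:: a1; a2; a3; a4]`_j) *m diag4 e1 e2 e3 e4
  = \row_(j < 4) [:: a1 * e1; a2 * e2; a3 * e3; a4 * e4]`_j.
Proof.
rewrite /diag4 mul_mx_diag; apply/rowP => j; rewrite !mxE.
by case: j => -[|[|[|[|//]]]].
Qed.

Lemma diag4_mul_col (R : realType) (a1 a2 a3 a4 e1 e2 e3 e4 : R[i]) :
  diag4 e1 e2 e3 e4 *m (\col_(i < 4) [:: a1; a2; a3; a4]`_i)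
  = \col_(i < 4) [:: e1 * a1; e2 * a2; e3 * a3; e4 * a4]`_i.
Proof.
rewrite /diag4 mul_diag_mx; apply/colP => j; rewrite !mxE.
by case: j => -[|[|[|[|//]]]].
Qed.

Lemma row_mul_col4 (R : realType) (a1 a2 a3 a4 b1 b2 b3 b4 : R[i]) :
  ((\row_(j < 4) [:: a1; a2; a3; a4]`_j) *m (\col_(i < 4) [:: b1; b2; b3; b4]`_i)) 0 0
  = a1 * b1 + a2 * b2 + a3 * b3 + a4 * b4.
Proof. by rewrite !mxE !big_ord_recl big_ord0 !mxE /= addr0 !addrA. Qed.

Lemma row_AQA_col (R : realType) (a1 a2 a3 a4 b1 b2 b3 b4 : R[i]) :
  ((\row_(j < 4) [:: a1; a2; a3; a4]`_j) *m AQA R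
    *m (\col_(i < 4) [:: b1; b2; b3; b4]`_i)) 0 0
  = (1 / 4)%:C * 'i%C * (a1 * b3 - a2 * b4 - a3 * b1 + a4 * b2).
Proof.
have -> : (\row_(j < 4) [:: a1; a2; a3; a4]`_j) *m AQA R
  = \row_(j < 4) [:: - ((1 / 4)%:C * 'i%C * a3); (1 / 4)%:C * 'i%C * a4;
       (1 / 4)%:C * 'i%C * a1; - ((1 / 4)%:C * 'i%C * a2)]`_j.
  apply/rowP => j; rewrite !mxE !big_ord_recl big_ord0 !mxE /=.
  by case: j => -[|[|[|[|//]]]] ? /=; ring.
by rewrite row_mul_col4; ring.
Qed.

Lemma row_W_path_col (R : realType) (al be r1 r2 s1 s2 : R) (tau : R[i]) (x : R)
    (l : 'rV[R[i]]_4) (c : 'cV[R[i]]_4) :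
  (l *m W_path al be r1 r2 s1 s2 tau x *m c) 0 0
  = (x^-1)%:C * ((l *m Dinv_path al be r1 r2 s1 s2 tau x) *m AQA R
       *m (D_path al be r1 r2 s1 s2 tau x *m c)) 0 0
    + (l *m Delta_path al be r1 r2 s1 s2 tau x *m c) 0 0.
Proof.
rewrite /W_path mulmxDr mulmxDl mxE; congr (_ + _).
by rewrite -(scalemxAr _ _ (AQA R)) -scalemxAl -scalemxAr -scalemxAl mxE !mulmxA.
Qed.

Lemma ray_powE (R : realType) (al a x : R) : 0 < x ->
  ray_pow al a x = (x `^ a)%:C * (cos (a * al) +i* sin (a * al)).
Proof.
move=> x0; rewrite /ray_pow /cexp ReM ImM /= !mul0r subr0 addr0.
by rewrite /powR gt_eqF.
Qed.

Lemma cos_sin_3pi2 (R : realType) :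
  cos (3 / 2 * pi : R) = 0 /\ sin (3 / 2 * pi : R) = -1.
Proof.
have -> : 3 / 2 * pi = pi + pi / 2 :> R by field.
by rewrite cosD sinD cospi sinpi cos_pihalf sin_pihalf; split; ring.
Qed.

Lemma sin_pi4 (R : realType) : sin (pi / 4 : R) = (Num.sqrt 2)^-1.
Proof.
have pi0 := pi_gt0 R.
have s0 : 0 < sin (pi / 4 : R) by apply: sin_gt0_pi; apply/andP; split; lra.
have E : sin (pi / 4 : R) ^+ 2 = 2^-1.
  have := cos_pihalf R; have -> : pi / 2 = pi / 4 + pi / 4 :> R by field.
  rewrite cosD -!expr2 cos2sin2; lra.
by rewrite -(gtr0_norm s0) -sqrtr_sqr E sqrtrV.
Qed.

Lemma sin_3pi4 (R : realType) : sin (3 / 4 * pi : R) = (Num.sqrt 2)^-1.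
Proof.
have -> : 3 / 4 * pi = pi - pi / 4 :> R by field.
by rewrite sinB cospi sinpi -sin_pi4; ring.
Qed.

Lemma powR32 (R : realType) (x : R) : 0 < x -> x `^ (3 / 2) = x * Num.sqrt x.
Proof.
move=> x0; have -> : 3 / 2 = 1 + 2^-1 :> R by field.
by rewrite powRD ?gt_eqF ?implybT // powRr1 ?ltW // powR12_sqrt ?ltW.
Qed.

Lemma powR12 (R : realType) (x : R) : 0 < x -> x `^ (1 / 2) = Num.sqrt x.
Proof. by move=> x0; rewrite div1r powR12_sqrt // ltW. Qed.

(** The real phase for which psi2 has boundary value i theta from above: with argument -pi,
    (-u)^(3/2) = i u^(3/2) and (-u)^(1/2) = -i u^(1/2). *)
Definition theta (R : realType) (r s x : R) : R :=
  2 / 3 * r * (x * Num.sqrt x) - 2 * s * Num.sqrt x.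

Lemma psi_path_Npi (R : realType) (r s x : R) : 0 < x ->
  psi_path (- pi) r s x = (theta r s x)%:C * 'i%C.
Proof.
move=> x0; have [c s'] := cos_sin_3pi2 R.
rewrite /psi_path !ray_powE // powR32 // powR12 // !mulrN !cosN !sinN c s'.
rewrite div1r [2^-1 * pi]mulrC cos_pihalf sin_pihalf /theta.
by apply: complexP; rewrite !(ReD, ImD, ReM, ImM) /=; ring.
Qed.

Lemma dpsi_path_Npi (R : realType) (r s x : R) : 0 < x ->
  dpsi_path (- pi) r s x = (r * Num.sqrt x - s / Num.sqrt x)%:C * 'i%C.
Proof.
move=> x0; have [c s'] := cos_sin_3pi2 R.
rewrite /dpsi_path !ray_powE // powR32 // powR12 // !mulrN !cosN !sinN c s'.
rewrite div1r [2^-1 * pi]mulrC cos_pihalf sin_pihalf.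
have q0 : Num.sqrt x != 0 by rewrite gt_eqF // sqrtr_gt0.
have xE : x = Num.sqrt x * Num.sqrt x by rewrite -expr2 sqr_sqrtr // ltW.
have e1 : r / x * (x * Num.sqrt x) = r * Num.sqrt x by field; rewrite gt_eqF.
have e2 : s / x * Num.sqrt x = s / Num.sqrt x by rewrite {1}xE; field.
by apply: complexP; rewrite !(ReD, ImD, ReM, ImM) /= -?e1 -?e2; ring.
Qed.

(** Arguments pi/2 and -pi/2 give conjugate values, so the difference is 2i times an imaginary part;
    sin(3 pi/4) = sin(pi/4) = 1/sqrt 2 is the source of the square roots of 2 in the cross
    expansion. *)
Lemma dpsi_path_conj (R : realType) (r s x : R) : 0 < x ->
  dpsi_path (pi / 2) r s x - dpsi_path (- (pi / 2)) r s x
  = (2 * (r * Num.sqrt x / Num.sqrt 2 + s / (Num.sqrt 2 * Num.sqrt x)))%:C * 'i%C.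
Proof.
move=> x0.
rewrite /dpsi_path !ray_powE // powR32 // powR12 // !mulrN !cosN !sinN.
have -> : 3 / 2 * (pi / 2) = 3 / 4 * pi :> R by field.
have -> : 1 / 2 * (pi / 2) = pi / 4 :> R by field.
rewrite sin_3pi4 sin_pi4.
have q0 : Num.sqrt x != 0 by rewrite gt_eqF // sqrtr_gt0.
have q2 : Num.sqrt 2 != 0 :> R by rewrite gt_eqF // sqrtr_gt0.
have xE : x = Num.sqrt x * Num.sqrt x by rewrite -expr2 sqr_sqrtr // ltW.
have e1 : r / x * (x * Num.sqrt x) = r * Num.sqrt x by field; rewrite gt_eqF.
have e2 : s / x * Num.sqrt x = s / Num.sqrt x by rewrite {1}xE; field.
have e3 : s / (Num.sqrt 2 * Num.sqrt x) = s / Num.sqrt x / Num.sqrt 2.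
  by field; rewrite q0 q2.
apply: complexP; rewrite !(ReD, ImD, ReN, ImN, ReM, ImM) /= e3 -?e1 -?e2; ring.
Qed.

Lemma Re_psi_path_conj (R : realType) (r s x : R) : 0 < x ->
  complex.Re (psi_path (pi / 2) r s x) = complex.Re (psi_path (- (pi / 2)) r s x).
Proof.
move=> x0; rewrite /psi_path !ray_powE // !mulrN !cosN !sinN.
by rewrite !(ReD, ReM) /=; ring.
Qed.

Lemma twopii_neq0 (R : realType) : 2 * pi%:C * 'i%C != 0 :> R[i].
Proof.
rewrite !mulf_neq0 ?neq0Ci ?pnatr_eq0 //.
by apply/eqP => /complexI/eqP; rewrite gt_eqF // pi_gt0.
Qed.

(** [Delta_path] contributes twice the derivative of psi2, that is, the first two terms; the
    conjugated [AQA] contributes e^(2 i theta) + e^(-2 i theta), that is, the cosine. *)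
Lemma tac_expansionE (R : realType) (r1 r2 s1 s2 x : R) : 0 < x ->
  (2 * pi%:C * 'i%C)^-1 * ((\row_(j < 4) [:: -1; 0; 1; 0]`_j)
    *m W_path (- pi) 0 r1 r2 s1 s2 0 x *m (\col_(i < 4) [:: 1; 0; 1; 0]`_i)) 0 0
  = tac_expansion r2 s2 x.
Proof.
move=> x0; rewrite row_W_path_col /Dinv_path /D_path /Delta_path.
rewrite !row_mul_diag4 diag4_mul_col row_AQA_col row_mul_col4.
rewrite !(mul0r, mulr0, addr0, mulr1, mul1r, subr0, mulN1r, opprK).
rewrite psi_path_Npi // dpsi_path_Npi // /tac_expansion.
have -> : upper_lim (psi2 r2 s2 : R[i] -> R[i]) x = psi_path (- pi) r2 s2 x.
  by apply: upper_limP; exact: cvg_upper_psi2.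
rewrite psi_path_Npi //; set th := theta _ _ _.
have q0 : Num.sqrt x != 0 by rewrite gt_eqF // sqrtr_gt0.
have pi0 : (pi : R) != 0 by rewrite gt_eqF // pi_gt0.
have E a : cexp (a%:C * 'i%C) = cos a +i* sin a :> R[i].
  by rewrite /cexp !(ReM, ImM) /= !(mul0r, mulr0, mulr1, subr0, addr0) expR0 mul1r.
have EN : - (th%:C * 'i%C) = (- th)%:C * 'i%C :> R[i] by rewrite rmorphN mulNr.
have E2 : 2 * (th%:C * 'i%C) = (th + th)%:C * 'i%C :> R[i].
  by apply: complexP; rewrite !(ReM, ImM) /=; ring.
rewrite E2 EN !E cosN sinN cosD.
apply: (canLR (mulKf (twopii_neq0 R))).
have xn : x != 0 by rewrite gt_eqF.
clear E EN E2; clearbody th; move: (pi : R) pi0 => p pi0.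
by apply: complexP; rewrite !(ReD, ImD, ReN, ImN, ReM, ImM) /=; field;
  rewrite ?xn ?q0 ?pi0.
Qed.

(** The vectors live on coordinates 1 and 2, which [AQA] does not couple, so only the difference of
    the first two entries of [Delta_path] remains. *)
Lemma cr_expansionE (R : realType) (s t x : R) : 0 < x ->
  (2 * pi%:C * 'i%C)^-1 * ((\row_(j < 4) [:: 1; -1; 0; 0]`_j)
    *m W_path (- (pi / 2)) (pi / 2) 1 1 s s (t%:C * 'i%C) x
    *m (\col_(i < 4) [:: 1; 1; 0; 0]`_i)) 0 0
  = cr_expansion s t x.
Proof.
move=> x0; rewrite row_W_path_col /Dinv_path /D_path /Delta_path.
rewrite !row_mul_diag4 diag4_mul_col row_AQA_col row_mul_col4.
rewrite !(mul0r, mulr0, addr0, mulr1, mul1r, subr0, mulN1r) add0r.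
set p := dpsi_path (- (pi / 2)) 1 s x; set q := dpsi_path (pi / 2) 1 s x.
have -> : - p + t%:C * 'i%C - (- q - t%:C * 'i%C) = (q - p) + 2 * t%:C * 'i%C by ring.
rewrite dpsi_path_conj // /cr_expansion; apply: (canLR (mulKf (twopii_neq0 R))).
have q0 : Num.sqrt x != 0 by rewrite gt_eqF // sqrtr_gt0.
have q2 : Num.sqrt 2 != 0 :> R by rewrite gt_eqF // sqrtr_gt0.
have pi0 : (pi : R) != 0 by rewrite gt_eqF // pi_gt0.
clear p q; move: (pi : R) pi0 => p pi0.
by apply: complexP; rewrite !(ReD, ImD, ReN, ImN, ReM, ImM) /=; field;
  rewrite ?q2 ?q0 ?pi0.
Qed.

Lemma kernel_log_derivative (R : realType) (N P Pi W N1 : 'M[R[i]]_4)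
    (l : 'rV[R[i]]_4) (c : 'cV[R[i]]_4) :
  Pi *m P = 1%:M -> N \in unitmx ->
  l *m invmx (N *m P) *m (N1 *m P + N *m (P *m W)) *m c
  = l *m (Pi *m (invmx N *m N1) *m P) *m c + l *m W *m c.
Proof.
move=> PiP uN.
have uP : P \in unitmx by case/mulmx1_unit: PiP.
have E : invmx (N *m P) = Pi *m invmx N.
  apply: (can_inj (mulmxK (_ : N *m P \in unitmx))); first by rewrite unitmx_mul uN.
  by rewrite mulVmx ?unitmx_mul ?uN // -mulmxA (mulmxA (invmx N)) mulVmx // mul1mx PiP.
rewrite E mulmxDr mulmxDl; congr (_ + _); rewrite !mulmxA //.
by congr (_ *m _ *m _); rewrite -!mulmxA (mulmxA (invmx N)) mulVmx // mul1mx PiP mulmx1.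
Qed.

(** The pointwise notation evaluates one remainder function at u, so the claim for all u is an
    equality of functions. *)
Lemma eqaddO_cmod (R : realType) (f g : R -> R[i]) (h : R -> R) (k : R) :
  (\forall u \near +oo, cmod (f u - g u) <= k * h u) ->
  forall u, f u = g u +O_(u \near pinfty_filter_on R) (h u)%:C.
Proof.
move=> H; set F := pinfty_filter_on R; pose e u := (h u)%:C.
suff E : f = g +O_ F e by move=> u; rewrite {1}E.
apply/eqaddOP; apply/bigO_exP; exists (`|k| + 1)%:C; first by rewrite ltcR ltr_wpDl.
move: H; apply: filterS => u Hu.
rewrite !normCE -rmorphM lecR cmodR; apply: (le_trans Hu).
apply: (@le_trans _ _ (`|k| * `|h u|)); first by rewrite -normrM ler_norm.
by rewrite ler_wpM2r // lerDl.
Qed.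

Lemma eqaddO_cmodP (R : realType) (f g : R -> R[i]) (h : R -> R) :
  (forall u, f u = g u +O_(u \near pinfty_filter_on R) (h u)%:C) ->
  exists k : R, \forall u \near +oo, cmod (f u - g u) <= k * `|h u|.
Proof.
move=> H; set F := pinfty_filter_on R; pose e u := (h u)%:C.
have E : f = g +O_ F e by apply/funext => u; rewrite {1}H.
move/eqaddOP: E => /bigO_exP[_/gt0_complexR[k k0 ->] Hk].
exists k; move: Hk; apply: filterS => u.
by rewrite !normCE -rmorphM lecR cmodR.
Qed.

(** * Asymptotics of the kernels *)

Lemma normmx_row4 (R : realType) (a b c d : R[i]) (e : R) :
  cmod a <= e -> cmod b <= e -> cmod c <= e -> cmod d <= e ->
  `|\row_(j < 4) [:: a; b; c; d]`_j| <= e%:C.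
Proof.
move=> ha hb hc hd.
have e0 : 0 <= e by apply: le_trans ha; exact: cmod_ge0.
apply: normmx_le => [|i j]; first by rewrite lecR.
by rewrite mxE normCE lecR; case: j => -[|[|[|[|//]]]].
Qed.

Lemma normmx_col4 (R : realType) (a b c d : R[i]) (e : R) :
  cmod a <= e -> cmod b <= e -> cmod c <= e -> cmod d <= e ->
  `|\col_(j < 4) [:: a; b; c; d]`_j| <= e%:C.
Proof.
move=> ha hb hc hd.
have e0 : 0 <= e by apply: le_trans ha; exact: cmod_ge0.
apply: normmx_le => [|i j]; first by rewrite lecR.
by rewrite mxE normCE lecR; case: i => -[|[|[|[|//]]]].
Qed.

Lemma row_mul_col4_eq0 (R : realType) (a1 a2 a3 a4 b1 b2 b3 b4 : R[i]) :
  a1 * b1 + a2 * b2 + a3 * b3 + a4 * b4 = 0 ->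
  (\row_(j < 4) [:: a1; a2; a3; a4]`_j) *m (\col_(i < 4) [:: b1; b2; b3; b4]`_i) = 0.
Proof.
by move=> h; apply/matrixP => i j; rewrite !ord1 row_mul_col4 h mxE.
Qed.

Lemma has_diffquo_near_eq (R : realType) (V : normedModType R[i]) (f g : R -> V)
    (u : R) (l : V) :
  (\forall v \near u, f v = g v) -> has_diffquo f u l -> has_diffquo g u l.
Proof.
move=> E; have Eu := nbhs_singleton E.
have E' : \forall v \near u^', f v = g v.
  change (\forall v \near u, v != u -> f v = g v).
  by apply: filterS E => v ? _.
apply: cvg_near_eq; move: E'; apply: filterS => v Ev.
by rewrite Eu Ev.
Qed.

Lemma near_pinftyP (R : realType) (A : set R) :
  (\forall x \near +oo, A x) -> exists r : R, forall x, r < x -> A x.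
Proof. by case=> r [_ h]; exists r. Qed.

Lemma cpow_imaginary (R : realType) (a x : R) : 0 < x ->
  cpow ('i%C * x%:C) a = ray_pow (pi / 2) a x.
Proof.
move=> x0; rewrite /cpow /ray_pow /clog /carg.
have -> : cmod ('i%C * x%:C) = x by rewrite cmodM cmod_i cmodR mul1r gtr0_norm.
rewrite ImM ReM /= !(mul0r, mul1r, subr0, add0r, mulr0) ltW //.
by rewrite oppr0 mul0r acos0.
Qed.

Lemma cpow_imaginaryN (R : realType) (a x : R) : 0 < x ->
  cpow (- ('i%C * x%:C)) a = ray_pow (- (pi / 2)) a x.
Proof.
move=> x0; rewrite /cpow /ray_pow /clog /carg.
have -> : cmod (- ('i%C * x%:C)) = x.
  by rewrite cmodN cmodM cmod_i cmodR mul1r gtr0_norm.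
rewrite ImN ReN ImM ReM /= !(mul0r, mul1r, subr0, add0r, mulr0) oppr_ge0.
by rewrite leNgt x0 /= !oppr0 mul0r acos0.
Qed.

Lemma P_path_imaginary (R : realType) (r1 r2 s1 s2 t x : R) : 0 < x ->
  Bmx ('i%C * x%:C) *m Amx R *m Dmx r1 r2 s1 s2 t ('i%C * x%:C)
  = P_path (- (pi / 2)) (pi / 2) r1 r2 s1 s2 (t%:C * 'i%C) x.
Proof.
move=> x0; rewrite /Bmx /Dmx /psi1 /psi2 !cpow_imaginary // !cpow_imaginaryN //.
by rewrite !(mulrA t%:C).
Qed.

Lemma tac_asymptotics (R : realType) (phi1 phi2 r1 r2 s1 s2 : R)
    (M : R[i] -> 'M[R[i]]_4) :
  0 < phi1 -> phi1 < phi2 -> phi2 < pi / 2 ->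
  RH_solution phi1 phi2 r1 r2 s1 s2 0 M ->
  exists k : R, \forall u \near +oo,
    cmod (Ktac M u u - tac_expansion r2 s2 u) <= k * u `^ (- (3 / 2)).
Proof.
move=> p1 p12 p2 hM; have [N [hN ME]] := RH_infinity hM.
have [N0 [N1 [B [r [hd hlim]]]]] := path_data_upper p1 p12 p2 hN.
have [B0 r_1 hd'] := hd.
pose P := P_path (- pi) 0 r1 r2 s1 s2 0.
have pi0 := pi_gt0 R.
have sp : 0 < sin phi1 by apply: sin_gt0_pi; apply/andP; split; lra.
have MlimE x : r < x -> upper_lim M x = N0 x *m P x.
  move=> rx; have x0 : 0 < x by lra.
  apply: upper_limP.
  have H : N w *m Bmx w *m Amx R *m Dmx r1 r2 s1 s2 0 w @[w --> upper_side x%:C] -->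
      N0 x *m B_path (- pi) 0 x *m Amx R *m D_path (- pi) 0 r1 r2 s1 s2 0%:C x.
    apply: cvg_mulmx; last exact: cvg_upper_Dmx.
    apply: cvg_mulmx; last exact: cvg_cst.
    by apply: cvg_mulmx; [exact: hlim|exact: cvg_upper_Bmx].
  rewrite /P /P_path !mulmxA; apply: (cvg_near_eq _ H).
  have : upper_side x%:C (sector phi1 0) by apply: upper_side_sector.
  apply: filterS => w /sector_notin_Sigma_M hw; rewrite ME //; exact: hw.
have [k0 hk] : exists k : R, \forall x \near +oo,
    cmod (((\row_(j < 4) [:: -1; 0; 1; 0]`_j)
     *m (Pinv_path (- pi) 0 r1 r2 s1 s2 0 x *m (invmx (N0 x) *m N1 x) *m P x)
     *m (\col_(i < 4) [:: 1; 0; 1; 0]`_i)) 0 0) <= k * x `^ (- (3 / 2)).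
  (* On the positive axis psi2 is purely imaginary and t = 0, so the exponentials that meet [l] and
     [c] have modulus 1. *)
  apply: (@path_estimate _ _ _ _ _ _ _ _ _ _ _ _ _ _ (fun=> 1) hd) => x x0.
  have c1 (z : R[i]) (a : R) : z = a%:C * 'i%C -> cmod (cexp z) = 1.
    by move=> ->; rewrite cmod_cexp ReM /= !(mulr0, mul0r) subr0 expR0.
  have E (th : R) : - (th%:C * 'i%C) = (- th)%:C * 'i%C :> R[i] by rewrite rmorphN mulNr.
  split=> //; split.
    rewrite invr1 /Dinv_path row_mul_diag4 !mul0r !addr0 psi_path_Npi //.
    rewrite opprK mulN1r mul1r E.
    by apply: normmx_row4; rewrite ?cmod0 ?cmodN ?(c1 _ _ erefl).
  rewrite /D_path diag4_mul_col !mulr0 !mul0r !addr0 psi_path_Npi // E !mulr1.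
  by apply: normmx_col4; rewrite ?cmod0 ?cmodN ?(c1 _ _ erefl).
exists (cmod ((2 * pi%:C * 'i%C : R[i])^-1) * k0).
have := nbhs_pinfty_gt (num_real r); move: (path_data_invmx hd) hk.
apply: filterS3 => u [uN _] hk ru; have u0 : 0 < u by lra.
have [dN _ _] := hd' u ru.
have dM := has_diffquo_mulmx dN (@has_diffquo_P_path _ (- pi) 0 r1 r2 s1 s2 0 u u0).
have {}dM : has_diffquo (upper_lim M) u
    (N1 u *m P u + N0 u *m (P u *m W_path (- pi) 0 r1 r2 s1 s2 0 u)).
  apply: has_diffquo_near_eq dM.
  have : \forall v \near u, r < v by exact: lt_nbhsr.
  by apply: filterS => v /MlimE.
have PiP := mulmx_Pinv_P (- pi) 0 r1 r2 s1 s2 0 u.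
have uP : P u \in unitmx by case/mulmx1_unit: PiP.
rewrite /Ktac (kernel_diagE dM); first last.
- by apply: row_mul_col4_eq0; ring.
- by rewrite MlimE // unitmx_mul uN.
rewrite MlimE // (@kernel_log_derivative _ _ _ _ _ _ _ _ PiP uN) mxE mulrDr.
rewrite tac_expansionE // addrK cmodM -[leRHS]mulrA.
by apply: ler_wpM2l; [exact: cmod_ge0|exact: hk].
Qed.

Lemma Cplus_invol (R : realType) : Cplus R *m Cplus R = 1%:M.
Proof.
apply/matrixP => i j; rewrite !mxE !big_ord_recl !big_ord0 !mxE.
by case: i => -[|[|[|[|//]]]] ?; case: j => -[|[|[|[|//]]]] ?;
  rewrite /= ?(mulr0, mul0r, mulr1, mul1r, addr0, add0r, mulrNN, mulrN1, oppr0).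
Qed.

Lemma Cplus_col (R : realType) :
  (Cplus R *m (\col_(i < 4) [:: 1; 1; 0; 0]`_i))^T = \row_(j < 4) [:: 1; -1; 0; 0]`_j.
Proof.
apply/matrixP => i j; rewrite !mxE !big_ord_recl !big_ord0 !mxE.
by case: j => -[|[|[|[|//]]]] ?;
  rewrite /= ?(mulr0, mul0r, mulr1, mul1r, addr0, add0r, mulrNN, mulrN1, oppr0).
Qed.

(** The sign found here cancels the one produced by exchanging u and v in [kernel_dual_diagE]. *)
Lemma row_Cplus (R : realType) :
  ((\row_(j < 4) [:: -1; 1; 0; 0]`_j) *m Cplus R)^T
  = - \col_(i < 4) [:: 1; 1; 0; 0]`_i.
Proof.
apply/matrixP => i j; rewrite !mxE !big_ord_recl !big_ord0 !mxE.
by case: i => -[|[|[|[|//]]]] ?;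
  rewrite /= ?(mulr0, mul0r, mulr1, mul1r, addr0, add0r, mulrNN, mulrN1, oppr0).
Qed.

Lemma cvg_upper_imaginary (R : realType) (M : R[i] -> 'M[R[i]]_4) (x : R) :
  derivable M ('i%C * x%:C) 1 ->
  M ('i%C * w) @[w --> upper_side x%:C] --> M ('i%C * x%:C).
Proof.
move=> /derivable1_diffP/differentiable_continuous cM.
have h : 'i%C * w @[w --> upper_side x%:C] --> 'i%C * x%:C.
  by apply: cvgM; [exact: cvg_cst|exact: cvg_within].
exact: (cvg_comp _ _ h cM).
Qed.

Lemma cr_asymptotics (R : realType) (phi1 phi2 s t : R)
    (M : R[i] -> 'M[R[i]]_4) :
  0 < phi1 -> phi1 < phi2 -> phi2 < pi / 2 ->
  RH_solution phi1 phi2 1 1 s s t M ->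
  exists k : R, \forall u \near +oo,
    cmod (Kcr M u u - cr_expansion s t u) <= k * u `^ (- (3 / 2)).
Proof.
move=> p1 p12 p2 hM; have [N [hN ME]] := RH_infinity hM.
have [N1 [B [r [B0 r_1 hd']]]] := path_data_imaginary p1 p12 p2 hN.
set N0 := fun x : R => N ('i%C * x%:C) in hd'.
have hd : path_data N0 N1 B r by split.
pose P := P_path (- (pi / 2)) (pi / 2) 1 1 s s (t%:C * 'i%C).
pose W := W_path (- (pi / 2)) (pi / 2) 1 1 s s (t%:C * 'i%C).
pose Pi := Pinv_path (- (pi / 2)) (pi / 2) 1 1 s s (t%:C * 'i%C).
pose M0 (x : R) := M ('i%C * x%:C).
have M0E x : 0 < x -> M0 x = N0 x *m P x.
  move=> x0; rewrite /M0 ME; last exact: imaginary_notin_Sigma_M.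
  by rewrite /P -P_path_imaginary // !mulmxA.
have PiP x : Pi x *m P x = 1%:M by exact: mulmx_Pinv_P.
have uP x : P x \in unitmx by case/mulmx1_unit: (PiP x).
have [k0 hk] : exists k : R, \forall x \near +oo,
    cmod (((\row_(j < 4) [:: 1; -1; 0; 0]`_j)
     *m (Pi x *m (invmx (N0 x) *m N1 x) *m P x)
     *m (\col_(i < 4) [:: 1; 1; 0; 0]`_i)) 0 0) <= k * x `^ (- (3 / 2)).
  (* The two phases are conjugate on the imaginary axis and t i x is imaginary, so the exponentials
     on coordinates 1 and 2 share one modulus [rho]. *)
  apply: (@path_estimate _ _ _ _ _ _ _ _ _ _ _ _ _ _
    (fun x => expR (- complex.Re (psi_path (- (pi / 2)) 1 s x))) hd) => x x0.
  split; first exact: expR_gt0.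
  have Ret : complex.Re (t%:C * 'i%C * x%:C) = 0.
    by rewrite !(ReM, ImM) /=; ring.
  rewrite -expRN opprK /Dinv_path /D_path row_mul_diag4 diag4_mul_col.
  rewrite !mul0r !mulr0 !mulr1 mul1r mulN1r.
  have := Re_psi_path_conj 1 s x0; move: Ret.
  move: (psi_path (- (pi / 2)) 1 s x) (psi_path (pi / 2) 1 s x) (t%:C * 'i%C * x%:C).
  move=> p q z z0 qp.
  split; [apply: normmx_row4|apply: normmx_col4];
    rewrite ?cmodN ?cmod0 ?cmod_cexp ?expR_ge0 // ler_expR !(ReN, ReD) z0 ?qp; lra.
have [r' hr'] := near_pinftyP (path_data_invmx hd).
exists (cmod ((2 * pi%:C * 'i%C : R[i])^-1) * k0).
have := nbhs_pinfty_gt (num_real r'); have := nbhs_pinfty_gt (num_real r); move: hk.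
apply: filterS3 => u hk ru ru'; have u0 : 0 < u by lra.
have uM0 x : 0 < x -> r' < x -> M0 x \in unitmx.
  by move=> x0 /hr'[uN _]; rewrite M0E // unitmx_mul uN uP.
have near_lim : \forall v \near u,
    upper_lim (Mtilde M) v = (invmx (M0 v))^T *m Cplus R.
  have h1 : \forall v \near u, 0 < v by exact: lt_nbhsr.
  have h2 : \forall v \near u, r' < v by exact: lt_nbhsr.
  move: h1 h2; apply: filterS2 => v v0 rv; apply: upper_limP.
  have dMv : derivable M ('i%C * v%:C) 1.
    by apply: (RH_analytic hM); exact: imaginary_notin_Sigma_M.
  have H : (invmx (M ('i%C * w)))^T *m Cplus R @[w --> upper_side v%:C] -->
      (invmx (M0 v))^T *m Cplus R.
    apply: cvg_mulmx; last exact: cvg_cst.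
    apply: cvg_trmx; apply: cvg_invmx; last exact: uM0.
    exact: cvg_upper_imaginary.
  apply: (cvg_near_eq _ H); move: (@near_upper_Im R v); apply: filterS => w w0.
  by rewrite /Mtilde w0.
have [dN _ _] := hd' u ru.
have dM : has_diffquo M0 u (N1 u *m P u + N0 u *m (P u *m W u)).
  have := has_diffquo_mulmx dN
    (@has_diffquo_P_path _ (- (pi / 2)) (pi / 2) 1 1 s s (t%:C * 'i%C) u u0).
  apply: has_diffquo_near_eq.
  have : \forall v \near u, 0 < v by exact: lt_nbhsr.
  by apply: filterS => v /M0E ->.
rewrite /Kcr (kernel_dual_diagE near_lim (Cplus_invol R) dM); first last.
- by apply: row_mul_col4_eq0; ring.
- exact: uM0.
rewrite Cplus_col row_Cplus mulmxN [X in _ * X]mxE mulrNN.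
have [uN _] := hr' u ru'.
rewrite M0E // (@kernel_log_derivative _ _ _ _ _ _ _ _ (PiP u) uN) mxE mulrDr.
rewrite cr_expansionE // addrK cmodM -[leRHS]mulrA.
by apply: ler_wpM2l; [exact: cmod_ge0|exact: hk].
Qed.

(** * The expansions differ *)

Lemma bounded_monomial (R : realType) (a C Y : R) (n : nat) :
  (forall y, Y < y -> `|a * y ^+ n.+1| <= C) -> a = 0.
Proof.
move=> h; apply/eqP/negPn/negP => a0.
have na0 : 0 < `|a| by rewrite normr_gt0.
(* The last summand makes |a| y exceed [C], and y >= 1 makes the power at least y. *)
pose y := `|Y| + 1 + (`|C| + 1) / `|a|.
have q0 : 0 <= (`|C| + 1) / `|a| by rewrite divr_ge0 // addr_ge0.
have Yy : Y < y by rewrite /y; have := ler_norm Y; lra.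
have y1 : 1 <= y by rewrite /y; have := normr_ge0 Y; lra.
have := h y Yy; rewrite normrM normrX (ger0_norm (_ : 0 <= y)); last by lra.
apply/negP; rewrite -ltNge; apply: (@lt_le_trans _ _ (`|a| * y)).
  rewrite /y !mulrDr [X in _ + X]mulrC divfK ?gt_eqF //.
  have := ler_norm C; have := mulr_ge0 (ltW na0) (normr_ge0 Y); lra.
by rewrite ler_pM2l // ler_eXnr.
Qed.

(** Combinations of dilates isolate the leading power. The weights 8, -6, 1 at y, 2y, 4y are the
    coefficients of (X - 2)(X - 4), which vanishes at 2^1 and 2^2 and equals 24 at 2^3; their
    absolute values sum to 15. Then g(2y) - 2 g(y) isolates the square. *)
Lemma bounded_cubic (R : realType) (a b c C Y : R) : 0 < Y ->
  (forall y, Y < y -> `|a * y ^+ 3 + b * y ^+ 2 + c * y| <= C) ->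
  [/\ a = 0, b = 0 & c = 0].
Proof.
move=> Y0 h; pose g y := a * y ^+ 3 + b * y ^+ 2 + c * y.
have a0 : a = 0.
  suff : 24 * a = 0 by lra.
  apply: (@bounded_monomial _ _ (15 * C) Y 2) => y yY.
  have := h (4 * y) ltac:(lra); have := h (2 * y) ltac:(lra); have := h y yY.
  rewrite !ler_norml => /andP[] h1 h2 /andP[] h3 h4 /andP[] h5 h6.
  have -> : 24 * a * y ^+ 3 = g (4 * y) - 6 * g (2 * y) + 8 * g y by rewrite /g; ring.
  by rewrite /g; apply/andP; split; lra.
have b0 : b = 0.
  suff : 2 * b = 0 by lra.
  apply: (@bounded_monomial _ _ (3 * C) Y 1) => y yY.
  have := h (2 * y) ltac:(lra); have := h y yY.
  rewrite a0 !ler_norml => /andP[] h1 h2 /andP[] h3 h4.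
  by apply/andP; split; lra.
split=> //; apply: (@bounded_monomial _ _ C Y 0) => y yY.
by have := h y yY; rewrite a0 b0 !mul0r !add0r.
Qed.

Lemma cos_natmul2pi (R : realType) (n : nat) : cos ((pi : R) *+ 2 *+ n) = 1.
Proof.
elim: n => [|n IH]; first by rewrite mulr0n cos0.
by rewrite mulrSr cosD2pi.
Qed.

(** The phase is continuous and unbounded above, so by the intermediate value theorem it attains a
    multiple of 2 pi lying above its value at Y + 1. *)
Lemma cubic_hits_2pi (R : realType) (r s Y : R) : 0 < r -> 0 < Y ->
  exists2 y, Y < y & cos (2 * (2 / 3 * r * y ^+ 3 - 2 * s * y)) = 1.
Proof.
move=> r0 Y0; pose g (y : R) := 2 * (2 / 3 * r * y ^+ 3 - 2 * s * y).
have cg : continuous g.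
  pose p : {poly R} := (4 / 3 * r)%:P * 'X^3 - (4 * s)%:P * 'X.
  have -> : g = horner p.
    apply/funext => y; rewrite /g /p.
    by rewrite hornerD hornerN !hornerCM hornerX hornerXn; field.
  exact: continuous_horner.
have pi0 := pi_gt0 R.
have [n hn] : exists n : nat, g (Y + 1) < pi *+ 2 *+ n.
  have p2 : 0 < (pi : R) *+ 2 by rewrite mulrn_wgt0.
  exists (Num.bound `|g (Y + 1) / (pi *+ 2)|).
  rewrite -[X in _ < X]mulr_natl -ltr_pdivrMr //.
  by apply: (le_lt_trans (ler_norm _)); apply: archi_boundP.
pose v : R := pi *+ 2 *+ n.
have v0 : 0 <= v by apply: mulrn_wge0; apply: mulrn_wge0; exact: ltW.
(* Chosen so that Z >= 1 and r Z >= v + 6 |s|; then 4/3 r Z^2 - 4 s is at least v, and multiplying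
   by Z gives g Z >= v. *)
pose Z := Y + 1 + (v + 6 * `|s| + 1) * (1 + r^-1).
have ri : 0 < r^-1 by rewrite invr_gt0.
have s0 := normr_ge0 s; have ss := ler_norm s.
have YZ : Y + 1 <= Z by rewrite /Z lerDl mulr_ge0 //; lra.
have gZ : v <= g Z.
  have Z1 : 1 <= Z by lra.
  have hZ : v + 6 * `|s| <= r * Z.
    have -> : r * Z = r * (Y + 1) + (v + 6 * `|s| + 1) * (r + 1).
      by rewrite /Z; field; rewrite gt_eqF.
    have h1 : 0 <= r * (Y + 1) by rewrite mulr_ge0 //; lra.
    have h2 : 0 <= (v + 6 * `|s| + 1) * r by rewrite mulr_ge0 //; lra.
    lra.
  have -> : g Z = (4 / 3 * (r * Z) * Z - 4 * s) * Z by rewrite /g; ring.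
  have h1 : r * Z <= r * Z * Z by rewrite ler_peMr //; lra.
  have h2 : v <= 4 / 3 * (r * Z) * Z - 4 * s by lra.
  apply: (le_trans h2); rewrite ler_peMr //; lra.
have [|y] := @IVT R g (Y + 1) Z v YZ (continuous_subspaceT cg).
  by rewrite ge_min le_max gZ orbT (ltW hn).
rewrite in_itv /= => /andP[y1 _] gy; exists y; first lra.
by rewrite -/(g y) gy cos_natmul2pi.
Qed.

Lemma expansions_differ (R : realType) (r2 s2 s t k : R) : 0 < r2 ->
  ~ (\forall u \near +oo, cmod (tac_expansion r2 s2 u - cr_expansion s t u)
       <= k * u `^ (- (3 / 2))).
Proof.
move=> r20 /near_pinftyP[U hU].
have pi0 := pi_gt0 R; have pin : (pi : R) != 0 by rewrite gt_eqF.
have q2 : 0 < Num.sqrt 2 :> R by rewrite sqrtr_gt0.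
(* The differences of the coefficients of u^(1/2), 1 and u^(-1/2); multiplication by u = y^2 turns
   these powers into y^3, y^2 and y. *)
pose a : R := (r2 - (Num.sqrt 2)^-1) / pi.
pose b : R := - t / pi.
pose c : R := - (s2 + s / Num.sqrt 2) / pi.
pose ph (y : R) := 2 * (2 / 3 * r2 * y ^+ 3 - 2 * s2 * y).
pose Y := `|U| + 1.
have Y0 : 0 < Y by rewrite /Y; have := normr_ge0 U; lra.
have key y : Y < y -> `|a * y ^+ 3 + b * y ^+ 2 + c * y - cos (ph y) / (4 * pi)| <= k / y.
  move=> yY; have y0 : 0 < y by lra.
  have yn : y != 0 by rewrite gt_eqF.
  have y2 : 0 < y ^+ 2 by rewrite exprn_gt0.
  have Uy : U < y ^+ 2.
    have h1 : y <= y ^+ 2 by rewrite ler_eXnr //; rewrite /Y in yY; have := normr_ge0 U; lra.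
    by have := ler_norm U; rewrite /Y in yY; lra.
  have := hU _ Uy.
  have sq : Num.sqrt (y ^+ 2) = y by rewrite sqrtr_sqr gtr0_norm.
  have thE : theta r2 s2 (y ^+ 2) = 2 / 3 * r2 * y ^+ 3 - 2 * s2 * y.
    by rewrite /theta sq; ring.
  have -> : (y ^+ 2) `^ (- (3 / 2)) = (y ^+ 3)^-1.
    by rewrite powRN powR32 // sq -exprSr.
  rewrite /tac_expansion /cr_expansion.
  have -> : upper_lim (psi2 r2 s2 : R[i] -> R[i]) (y ^+ 2) = psi_path (- pi) r2 s2 (y ^+ 2).
    by apply: upper_limP; exact: cvg_upper_psi2.
  rewrite psi_path_Npi // thE sq.
  have -> : complex.Re (cexp (2 * ((2 / 3 * r2 * y ^+ 3 - 2 * s2 * y)%:C * 'i%C))) = cos (ph y).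
    have -> : 2 * ((2 / 3 * r2 * y ^+ 3 - 2 * s2 * y)%:C * 'i%C) = 0 +i* ph y :> R[i].
      by apply: complexP; rewrite !(ReM, ImM) /= /ph; ring.
    by rewrite Re_cexp /= expR0 mul1r.
  rewrite -rmorphB cmodR => h.
  have -> : a * y ^+ 3 + b * y ^+ 2 + c * y - cos (ph y) / (4 * pi)
    = y ^+ 2 * (r2 * y / pi - s2 / (pi * y) - 1 / (4 * pi * y ^+ 2) * cos (ph y)
       - (y / (Num.sqrt 2 * pi) + t / pi + s / (Num.sqrt 2 * pi * y))).
    rewrite /a /b /c; move: (cos _) (Num.sqrt 2) q2 (pi : R) pin => C q q0 p pn.
    by field; rewrite yn pn gt_eqF.
  rewrite normrM (gtr0_norm y2).
  have -> : k / y = y ^+ 2 * (k * (y ^+ 3)^-1) by field; rewrite yn.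
  by rewrite ler_pM2l.
pose Z := Y + `|k|.
have C1 y : Y < y -> `|k / y| <= `|k| / Y.
  move=> yY; rewrite normrM normfV (gtr0_norm (_ : 0 < y)); last lra.
  by rewrite ler_wpM2l // lef_pV2 ?posrE //; lra.
have [a0 b0 c0] : [/\ a = 0, b = 0 & c = 0].
  apply: (@bounded_cubic _ _ _ _ (`|k| / Y + `|1 / (4 * pi)|) Y Y0) => y yY.
  have -> : a * y ^+ 3 + b * y ^+ 2 + c * y
    = (a * y ^+ 3 + b * y ^+ 2 + c * y - cos (ph y) / (4 * pi)) + cos (ph y) / (4 * pi).
    by rewrite subrK.
  apply: (le_trans (ler_normD _ _)); apply: lerD.
    by apply: (le_trans (key y yY)); apply: le_trans (C1 y yY); exact: ler_norm.
  rewrite !normrM normr1 ler_wpM2r // ler_norml cos_geN1 cos_le1 //.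
(* Once the cubic is gone, a cosine equal to 1 gives 1/(4 pi) <= |k|/y, which fails beyond 4 pi
   |k|. *)
have [y yZ cy] := @cubic_hits_2pi R r2 s2 (Y + 4 * pi * `|k|) r20
  ltac:(have := mulr_ge0 (mulr_ge0 (ler0n R 4) (ltW pi0)) (normr_ge0 k); lra).
have pk : 0 <= 4 * pi * `|k| by rewrite !mulr_ge0 // ltW.
have yY : Y < y by lra.
have y0 : 0 < y by lra.
have := key y yY; rewrite a0 b0 c0 !mul0r !add0r normrN /ph cy.
rewrite ger0_norm ?divr_ge0 ?mulr_ge0 ?(ltW pi0) // => h.
have := le_trans h (le_trans (ler_norm _) (_ : `|k / y| <= `|k| / y)).
rewrite normrM normfV (gtr0_norm y0) lexx => /(_ isT).
rewrite ler_pdivlMr // mul1r mulrC -ler_pdivlMr ?invr_gt0 ?mulr_gt0 // invrK.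
lra.
Qed.

Unset Implicit Arguments.
Set Strict Implicit.
Theorem mainTheorem4 (R : realType) (phi1 phi2 : R)
  (phi1_gt0 : 0 < phi1) (phi1_lt_phi2 : phi1 < phi2)
  (phi2_lt_pihalf : phi2 < pi / 2) :
  [/\ forall (r1 r2 s1 s2 : R) (M : R[i] -> 'M[R[i]]_4),
        0 < r1 -> 0 < r2 ->
        RH_solution phi1 phi2 r1 r2 s1 s2 0 M ->
        forall u : R, Ktac M u u = tac_expansion r2 s2 u
          +O_(u \near pinfty_filter_on R) (u `^ (- (3 / 2)))%:C,
      forall (s t : R) (M : R[i] -> 'M[R[i]]_4),
        RH_solution phi1 phi2 1 1 s s t M ->
        forall u : R, Kcr M u u = cr_expansion s t u
          +O_(u \near pinfty_filter_on R) (u `^ (- (3 / 2)))%:C,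
      forall r1 r2 s1 s2 s t : R, 0 < r1 -> 0 < r2 ->
        ~ (forall u : R, tac_expansion r2 s2 u = cr_expansion s t u
             +O_(u \near pinfty_filter_on R) (u `^ (- (3 / 2)))%:C)
    & forall (r1 r2 s1 s2 s t : R) (Mtac Mcr : R[i] -> 'M[R[i]]_4),
        0 < r1 -> 0 < r2 ->
        RH_solution phi1 phi2 r1 r2 s1 s2 0 Mtac ->
        RH_solution phi1 phi2 1 1 s s t Mcr ->
        exists u v : R, [/\ 0 < u, 0 < v & Ktac Mtac u v <> Kcr Mcr u v]].
Proof.
split.
- move=> r1 r2 s1 s2 M r1_gt0 r2_gt0 hM.
  have [k hk] := tac_asymptotics phi1_gt0 phi1_lt_phi2 phi2_lt_pihalf hM.
  exact: eqaddO_cmod hk.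
- move=> s t M hM.
  have [k hk] := cr_asymptotics phi1_gt0 phi1_lt_phi2 phi2_lt_pihalf hM.
  exact: eqaddO_cmod hk.
- move=> r1 r2 s1 s2 s t _ r2_gt0 /eqaddO_cmodP[k hk].
  apply: (@expansions_differ R r2 s2 s t k r2_gt0).
  by move: hk; apply: filterS => u; rewrite ger0_norm ?powR_ge0.
- move=> r1 r2 s1 s2 s t Mtac Mcr _ r2_gt0 htac hcr; apply: contrapT => hne.
  (* The diagonal already separates the kernels: equal diagonal values would make the two expansions
     agree up to (k1 + k2) u^(-3/2). *)
  have Keq (u : R) : 0 < u -> Ktac Mtac u u = Kcr Mcr u u.
    move=> u0; apply: contrapT => ne; apply: hne; exists u, u; by [].
  have [k1 h1] := tac_asymptotics phi1_gt0 phi1_lt_phi2 phi2_lt_pihalf htac.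
  have [k2 h2] := cr_asymptotics phi1_gt0 phi1_lt_phi2 phi2_lt_pihalf hcr.
  apply: (@expansions_differ R r2 s2 s t (k1 + k2) r2_gt0).
  have := nbhs_pinfty_gt (num_real (0 : R)); move: h1 h2.
  apply: filterS3 => u h1 h2 u0; rewrite mulrDl.
  have -> : tac_expansion r2 s2 u - cr_expansion s t u
    = (tac_expansion r2 s2 u - Ktac Mtac u u) + (Kcr Mcr u u - cr_expansion s t u).
    by rewrite Keq // addrA subrK.
  apply: (le_trans (ler_cmodD _ _)); apply: lerD; last exact: h2.
  by rewrite cmodB.
Qed.
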